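(* Let $\mathbf{k}$ be a field, $H$ a cocommutative Hopf algebra over $\mathbf{k}$, and let $0\to(M,[\cdot*\cdot]_M)\xrightarrow{i}(E,[\cdot*\cdot]_E)\xrightarrow{p}(L,[\cdot*\cdot]_L)\to0$ be a non-abelian extension of Lie $H$-pseudoalgebras. Then there is an exact sequence $$1\to\mathrm{Aut}_M^{M,L}(E)\xrightarrow{\iota}\mathrm{Aut}_M(E)\xrightarrow{\tau}\mathrm{Aut}(M)\times\mathrm{Aut}(L)\xrightarrow{\mathcal W}H^2_{nab}(L,M),$$ where $\iota$ is the inclusion and $\mathcal W$ is the Wells map of the extension. (Exactness means: $\iota$ is injective, $\mathrm{im}(\iota)=\ker(\tau)$, and $\mathrm{im}(\tau)=\ker(\mathcal W)=\{(\beta,\alpha):\mathcal W((\beta,\alpha))=0\}$.)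
   Context: **Basic conventions.** $\otimes=\otimes_{\mathbf k}$; $\Delta(h)=h_{(1)}\otimes h_{(2)}$ (Sweedler). $H^{\otimes n}$ is a left $H^{\otimes n}$-module by multiplication and a right $H$-module via the iterated comultiplication. Since $H$ is cocommutative, permutations of the tensor factors of $H^{\otimes n}$ are right $H$-linear and induce maps on $H^{\otimes n}\otimes_H Z$ for every left $H$-module $Z$. Here $\sigma_{12}$ interchanges the first two tensor factors, and $\sigma_{1\to 3}(h_3\otimes h_1\otimes h_2)=h_1\otimes h_2\otimes h_3$ on $H^{\otimes 3}$. For left $H$-modules $X,Y,Z$, a $\mathbf k$-linear map $A:X\otimes Y\to H^{\otimes 2}\otimes_H Z$ is $H^{\otimes 2}$-linear if $A(fx,gy)=((f\otimes g)\otimes_H 1)A(x,y)$ for $f,g\in H$; $\mathrm{Hom}_{H^{\otimes 2}}(X\otimes Y,H^{\otimes 2}\otimes_H Z)$ is the set of such maps. If $X=Y$, $A$ is skew-symmetric if $A(y,x)=-(\sigma_{12}\otimes_H 1)A(x,y)$. Compositions: for $w=\sum_i(f_i\otimes g_i)\otimes_H e_i\in H^{\otimes 2}\otimes_H X$ and $A(e_i,z)=\sum_j(f_{ij}\otimes g_{ij})\otimes_H e_{ij}$ put $A(w,z)=\sum_{i,j}(f_if_{ij(1)}\otimes g_if_{ij(2)}\otimes g_{ij})\otimes_H e_{ij}$. For $w=\sum_i(h_i\otimes l_i)\otimes_H d_i\in H^{\otimes 2}\otimes_H Y$ and $A(x,d_i)=\sum_j(h_{ij}\otimes l_{ij})\otimes_H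 d_{ij}$ put $A(x,w)=\sum_{i,j}(h_{ij}\otimes h_il_{ij(1)}\otimes l_il_{ij(2)})\otimes_H d_{ij}$. Both lie in $H^{\otimes 3}\otimes_H Z$. **Lie $H$-pseudoalgebra.** A left $H$-module $L$ with a skew-symmetric $H^{\otimes 2}$-linear map $[\cdot*\cdot]_L:L\otimes L\to H^{\otimes 2}\otimes_H L$ satisfying $[[x*y]_L*z]_L=[x*[y*z]_L]_L-(\sigma_{12}\otimes_H 1)[y*[x*z]_L]_L$. A homomorphism $\Theta:L\to L'$ is an $H$-linear map with $[\Theta(x)*\Theta(y)]_{L'}=(\mathrm{id}_{H^{\otimes 2}}\otimes_H\Theta)[x*y]_L$; $\mathrm{Aut}(L)$ is the group of bijective homomorphisms $L\to L$. **Extensions and cocycles.** A non-abelian extension of $L$ by $M$ is a Lie $H$-pseudoalgebra $E$ with a short exact sequence of Lie $H$-pseudoalgebras $0\to M\xrightarrow{i}E\xrightarrow{p}L\to0$; $M$ is identified with $i(M)\subset E$. A section of $p$ is an $H$-linear $s:L\to E$ with $p\circ s=\mathrm{id}_L$ (the source asserts that a section always exists). A non-abelian $2$-cocycle of $L$ with values in $M$ is a pair $(\chi,\psi)$ with $\chi\in\mathrm{Hom}_{H^{\otimes 2}}(L\otimes L,H^{\otimes 2}\otimes_H M)$ skew-symmetric and $\psi\in\mathrm{Hom}_{H^{\otimes 2}}(L\otimes M,H^{\otimes 2}\otimes_H M)$ such that for all $x,y,z\in L$, $u,v\in M$: 1. $[\psi(x,u)*v]_M=\psi(x,[u*v]_M)-(\sigma_{12}\otimes_H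 1)[u*\psi(x,v)]_M$; 2. $\psi(x,\psi(y,u))-(\sigma_{12}\otimes_H 1)\psi(y,\psi(x,u))-\psi([x*y]_L,u)=[\chi(x,y)*u]_M$; 3. $\psi(x,\chi(y,z))-(\sigma_{12}\otimes_H 1)\psi(y,\chi(x,z))+(\sigma_{1\to 3}\otimes_H 1)\psi(z,\chi(x,y))+\chi(x,[y*z]_L)-(\sigma_{12}\otimes_H 1)\chi(y,[x*z]_L)+(\sigma_{1\to 3}\otimes_H 1)\chi(z,[x*y]_L)=0$. Two cocycles $(\chi,\psi)$, $(\chi',\psi')$ are equivalent if there is an $H$-linear map $\varphi:L\to M$ such that for all $x,y\in L$, $u\in M$: $\psi(x,u)-\psi'(x,u)=[\varphi(x)*u]_M$ and $\chi(x,y)-\chi'(x,y)=\psi'(x,\varphi(y))-(\sigma_{12}\otimes_H 1)\psi'(y,\varphi(x))-(\mathrm{id}_{H^{\otimes 2}}\otimes_H\varphi)[x*y]_L+[\varphi(x)*\varphi(y)]_M$. $H^2_{nab}(L,M)$ is the set of equivalence classes; $0$ denotes the class of the zero cocycle $(0,0)$. A section $s$ of $p$ induces the non-abelian $2$-cocycle $\chi(x,y)=[s(x)*s(y)]_E-(\mathrm{id}_{H^{\otimes 2}}\otimes_H s)[x*y]_L$, $\psi(x,u)=[s(x)*u]_E$. **Automorphism groups.** $\mathrm{Aut}_M(E)$ is the group of all automorphisms $\gamma\in\mathrm{Aut}(E)$ with $\gamma(M)\subset M$. For $\gamma\in\mathrm{Aut}_M(E)$ one has $\gamma|_M\in\mathrm{Aut}(M)$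 and $\overline\gamma:=p\gamma s\in\mathrm{Aut}(L)$ for any section $s$ (independent of $s$), and $\tau(\gamma)=(\gamma|_M,\overline\gamma)$ defines a group homomorphism $\tau:\mathrm{Aut}_M(E)\to\mathrm{Aut}(M)\times\mathrm{Aut}(L)$. $\mathrm{Aut}_M^{M,L}(E)=\{\gamma\in\mathrm{Aut}_M(E):\tau(\gamma)=(\mathrm{id}_M,\mathrm{id}_L)\}$. **Wells map.** Let $s$ be any section of $p$ and $(\chi,\psi)$ the non-abelian $2$-cocycle induced by $s$. For $(\beta,\alpha)\in\mathrm{Aut}(M)\times\mathrm{Aut}(L)$ define the non-abelian $2$-cocycle $\chi_{(\beta,\alpha)}(x,y)=(\mathrm{id}_{H^{\otimes 2}}\otimes_H\beta)\chi(\alpha^{-1}(x),\alpha^{-1}(y))$, $\psi_{(\beta,\alpha)}(x,u)=(\mathrm{id}_{H^{\otimes 2}}\otimes_H\beta)\psi(\alpha^{-1}(x),\beta^{-1}(u))$. The Wells map $\mathcal W:\mathrm{Aut}(M)\times\mathrm{Aut}(L)\to H^2_{nab}(L,M)$ is $$\mathcal W((\beta,\alpha)):=[(\chi_{(\beta,\alpha)},\psi_{(\beta,\alpha)})-(\chi,\psi)],$$ the equivalence class of $(\chi_{(\beta,\alpha)},\psi_{(\beta,\alpha)})-(\chi,\psi)$; it does not depend on the chosen section.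
   Formalization: W((β,α)) is the class of the difference relative to the cocycle (χ,ψ), so W=0 means (χ_(β,α),ψ_(β,α)) is equivalent to (χ,ψ) (the literal reading is false); Aut_M(E) requires γ(M)=M rather than γ(M)⊂M; an H-linear section s is assumed given, as it need not exist. *)

(* Defs.v *)
From HB Require Import structures.
From mathcomp Require Import all_boot all_order all_algebra.
From mathcomp Require Import boolp classical_sets functions.

Set Implicit Arguments.
Unset Strict Implicit.
Unset Printing Implicit Defensive.

Import GRing.Theory.
Local Open Scope ring_scope.
Local Open Scope quotient_scope.

Section TensorRelation.
Variables (R : pzRingType) (T : zmodType) (ract : T -> R -> T) (Z : lmodType R).

(* The list [:: (t1, z1); ...; (tn, zn)] stands for the formal sum            *)
(* t1 (x) z1 + ... + tn (x) zn; tens_eq is the least congruence imposing      *)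
(* biadditivity and R-balancedness.                                           *)
Inductive tens_eq : seq (T * Z) -> seq (T * Z) -> Prop :=
| tens_refl s : tens_eq s s
| tens_sym s s' : tens_eq s s' -> tens_eq s' s
| tens_trans s s' s'' : tens_eq s s' -> tens_eq s' s'' -> tens_eq s s''
| tens_cat s s' t t' : tens_eq s s' -> tens_eq t t' ->
    tens_eq (s ++ t) (s' ++ t')
| tens_catC s t : tens_eq (s ++ t) (t ++ s)
| tens_0l z : tens_eq [:: (0, z)] [::]
| tens_Dl x y z : tens_eq [:: (x + y, z)] [:: (x, z); (y, z)]
| tens_Dr x z z' : tens_eq [:: (x, z + z')] [:: (x, z); (x, z')]
| tens_bal x a z : tens_eq [:: (ract x a, z)] [:: (x, a *: z)].

Definition tens_eqb : rel (seq (T * Z)) := fun s s' => `[< tens_eq s s' >].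

Lemma tens_eqb_equiv : equiv_class_of tens_eqb.
Proof.
split=> [s|s s'|s' s s''].
- by apply/asboolP; exact: tens_refl.
- by apply/asboolP/asboolP; exact: tens_sym.
- by move=> /asboolP h /asboolP h'; apply/asboolP; exact: tens_trans h h'.
Qed.

Definition tens_equiv := EquivRelPack tens_eqb_equiv.
End TensorRelation.

(* T (x)_R Z, for a right R-module T with action ract and a left R-module Z.  *)
Definition tensor (R : pzRingType) (T : zmodType) (ract : T -> R -> T)
  (Z : lmodType R) := {eq_quot (tens_equiv ract Z)}.

Section Tensor.
Variables (R : pzRingType) (T : zmodType) (ract : T -> R -> T) (Z : lmodType R).
Local Notation TZ := (tensor ract Z).
Local Notation "s ~ t" := (tens_eq ract s t) (at level 70).

HB.instance Definition _ := Choice.on TZ.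
HB.instance Definition _ := EqQuotient.on TZ.

Lemma tens_piP s t : (\pi_TZ s = \pi_TZ t) <-> s ~ t.
Proof.
split=> [/eqP|h]; first by rewrite eqmodE => /asboolP.
by apply/eqP; rewrite eqmodE; apply/asboolP.
Qed.

Lemma tens_reprP s : repr (\pi_TZ s) ~ s.
Proof. by apply/tens_piP; rewrite reprK. Qed.

Definition tens0 : TZ := \pi_TZ [::].
Definition tens_add (u v : TZ) : TZ := \pi_TZ (repr u ++ repr v).
Definition tens_opp_seq (s : seq (T * Z)) := [seq (- xz.1, xz.2) | xz <- s].
Definition tens_opp (u : TZ) : TZ := \pi_TZ (tens_opp_seq (repr u)).
Definition pure (x : T) (z : Z) : TZ := \pi_TZ [:: (x, z)].

Lemma tens_addE s t : tens_add (\pi_TZ s) (\pi_TZ t) = \pi_TZ (s ++ t).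
Proof. by apply/tens_piP; apply: tens_cat; exact: tens_reprP. Qed.

Lemma tens_opp_seqP s : tens_opp_seq s ++ s ~ [::].
Proof.
elim: s => [|[x z] s IH]; first exact: tens_refl.
apply: (tens_trans (s' := [:: (- x, z); (x, z)] ++ (tens_opp_seq s ++ s))).
  have -> : tens_opp_seq ((x, z) :: s) ++ (x, z) :: s =
      [:: (- x, z)] ++ (tens_opp_seq s ++ [:: (x, z)]) ++ s by rewrite /= -catA.
  apply: tens_cat (tens_refl _ [:: (- x, z)]) _.
  by apply: tens_cat (tens_catC _ _ [:: (x, z)]) (tens_refl _ s).
rewrite -[X in _ ~ X]cats0; apply: tens_cat; last exact: IH.
apply: (tens_trans (tens_sym (tens_Dl ract (- x) x z))).
rewrite addNr; exact: tens_0l.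
Qed.

Lemma tens_addA : associative tens_add.
Proof.
elim/quotW=> u; elim/quotW=> v; elim/quotW=> w.
by rewrite (tens_addE v) (tens_addE u) (tens_addE u) tens_addE catA.
Qed.

Lemma tens_addC : commutative tens_add.
Proof. by move=> u v; apply/tens_piP; exact: tens_catC. Qed.

Lemma tens_add0 : left_id tens0 tens_add.
Proof. by elim/quotW=> u; rewrite /tens0 tens_addE. Qed.

Lemma tens_addN : left_inverse tens0 tens_opp tens_add.
Proof.
move=> u; rewrite -[X in tens_add _ X]reprK /tens_opp tens_addE.
by apply/tens_piP; exact: tens_opp_seqP.
Qed.

HB.instance Definition _ :=
  GRing.isZmodule.Build TZ tens_addA tens_addC tens_add0 tens_addN.

Lemma tens_catE s t : \pi_TZ (s ++ t) = \pi_TZ s + \pi_TZ t.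
Proof. by rewrite [RHS]tens_addE. Qed.

Lemma pureDl x y z : pure (x + y) z = pure x z + pure y z.
Proof. by rewrite -tens_catE; apply/tens_piP; exact: tens_Dl. Qed.

Lemma pureDr x z z' : pure x (z + z') = pure x z + pure x z'.
Proof. by rewrite -tens_catE; apply/tens_piP; exact: tens_Dr. Qed.

Lemma pure_bal x a z : pure (ract x a) z = pure x (a *: z).
Proof. by apply/tens_piP; exact: tens_bal. Qed.

Lemma tens_sumE (u : TZ) : u = \sum_(xz <- repr u) pure xz.1 xz.2.
Proof.
rewrite -[LHS]reprK; elim: (repr u) => [|[x z] s IH]; first by rewrite big_nil.
by rewrite big_cons -cat1s tens_catE IH.
Qed.

Section Lift.
Variables (V : zmodType) (f : T -> Z -> V).

(* The additive map x (x) z |-> f x z.  It is computed on a chosen formal sum;*)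
(* by tlift_pi the choice does not matter when f is balanced.                 *)
Definition tlift (u : TZ) : V := \sum_(xz <- repr u) f xz.1 xz.2.

Definition balanced :=
  [/\ forall x y z, f (x + y) z = f x z + f y z,
      forall x z z', f x (z + z') = f x z + f x z'
    & forall x a z, f (ract x a) z = f x (a *: z)].

Hypothesis fP : balanced.

Lemma tlift_pi s : tlift (\pi_TZ s) = \sum_(xz <- s) f xz.1 xz.2.
Proof.
case: fP => fDl fDr fb.
suff: forall s s', s ~ s' ->
    \sum_(xz <- s) f xz.1 xz.2 = \sum_(xz <- s') f xz.1 xz.2.
  by apply; exact: tens_reprP.
move=> {}s s'; elim=> {s s'} //.
- by move=> s s' s'' _ -> _ ->.
- by move=> s s' t t' _ h _ h'; rewrite !big_cat /= h h'.
- by move=> s t; rewrite !big_cat /= addrC.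
- move=> z; rewrite big_seq1 big_nil /=.
  by apply: (addrI (f 0 z)); rewrite -fDl !addr0.
- by move=> x y z; rewrite !big_cons big_nil /= fDl !addr0.
- by move=> x z z'; rewrite !big_cons big_nil /= fDr !addr0.
- by move=> x a z; rewrite !big_seq1 /= fb.
Qed.

Lemma tlift_pure x z : tlift (pure x z) = f x z.
Proof. by rewrite (tlift_pi [:: (x, z)]) big_seq1. Qed.

Lemma tliftD : {morph tlift : u v / u + v}.
Proof.
elim/quotW=> u; elim/quotW=> v.
by rewrite -tens_catE (tlift_pi u) (tlift_pi v) tlift_pi big_cat.
Qed.
End Lift.

Lemma tens_ind (P : TZ -> Prop) :
  P 0 -> (forall x z u, P u -> P (pure x z + u)) -> forall u, P u.
Proof.
move=> P0 PD u; rewrite [u]tens_sumE; elim: (repr u) => [|xz s IH].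
  by rewrite big_nil.
by rewrite big_cons; apply: PD.
Qed.

End Tensor.
Arguments pure {R T ract Z} x z.
Arguments tlift {R T ract Z V} f u.

Lemma tens_eq_morph (R : pzRingType) (T : zmodType) (ract : T -> R -> T)
    (Z : lmodType R) (V : zmodType) (f g : tensor ract Z -> V) :
    {morph f : u v / u + v} -> {morph g : u v / u + v} ->
    (forall x z, f (pure x z) = g (pure x z)) -> f =1 g.
Proof.
move=> fD gD fg; have h0 (h : tensor ract Z -> V) :
  {morph h : u v / u + v} -> h 0 = 0.
  by move=> hD; apply: (addrI (h 0)); rewrite -hD !addr0.
elim/tens_ind=> [|x z u IH]; first by rewrite !h0.
by rewrite fD gD fg IH.
Qed.

HB.mixin Record isAugmented (k : fieldType) A of GRing.Algebra k A := {
  counit : {lrmorphism A -> k^o}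
}.
#[short(type="augAlgType")]
HB.structure Definition Augmented (k : fieldType) :=
  {A of GRing.Algebra k A & isAugmented k A}.

(* The tensor product over k of augmented algebras.  Augmentations are only   *)
(* used to know that A (x) B is a nonzero ring, as required by algType.       *)
Definition tensk (k : fieldType) (A B : augAlgType k) :=
  tensor (fun (x : A) (c : k) => c *: x) B.

Section TensorAlgebra.
Variables (k : fieldType) (A B : augAlgType k).
Local Notation AB := (tensk A B).

HB.instance Definition _ := GRing.Zmodule.on AB.

Definition tk_scale (c : k) (u : AB) : AB :=
  tlift (fun x y => pure (c *: x) y) u.
Definition tk_one : AB := pure 1 1.
Definition tk_mul (u v : AB) : AB :=
  tlift (fun x y => tlift (fun x' y' => pure (x * x') (y * y')) v) u.
Definition tk_counit (u : AB) : k :=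
  tlift (fun x y => (counit x : k) * (counit y : k)) u.

Fact tk_scaleP c :
  balanced (fun (x : A) (c : k) => c *: x)
    (fun x y => pure (c *: x) y : AB).
Proof.
split=> *; rewrite ?scalerDr ?pureDl ?pureDr //.
by rewrite -pure_bal /= !scalerA mulrC.
Qed.

Fact tk_mulrP x y :
  balanced (fun (x : A) (c : k) => c *: x)
    (fun x' y' => pure (x * x') (y * y') : AB).
Proof.
split=> *; rewrite ?mulrDr ?pureDl ?pureDr //.
by rewrite -scalerAr -[RHS]/(pure _ _) -scalerAr -pure_bal.
Qed.

Fact tk_mullP (v : AB) :
  balanced (fun (x : A) (c : k) => c *: x)
    (fun x y => tlift (fun x' y' => pure (x * x') (y * y') : AB) v).
Proof.
split.
- move=> x1 x2 y; move: v; apply: tens_eq_morph.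
  + exact: tliftD (tk_mulrP _ _).
  + move=> u v; rewrite !(tliftD (tk_mulrP _ _)); exact: addrACA.
  + by move=> x z; rewrite !(tlift_pure (tk_mulrP _ _)) mulrDl pureDl.
- move=> x y1 y2; move: v; apply: tens_eq_morph.
  + exact: tliftD (tk_mulrP _ _).
  + move=> u v; rewrite !(tliftD (tk_mulrP _ _)); exact: addrACA.
  + by move=> x' z; rewrite !(tlift_pure (tk_mulrP _ _)) mulrDl pureDr.
- move=> x a z; move: v; apply: tens_eq_morph.
  + exact: tliftD (tk_mulrP _ _).
  + exact: tliftD (tk_mulrP _ _).
  + move=> x' y'; rewrite !(tlift_pure (tk_mulrP _ _)).
    by rewrite -!scalerAl -pure_bal.
Qed.

Fact tk_counitP :
  balanced (fun (x : A) (c : k) => c *: x)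
    (fun (x : A) (y : B) => (counit x : k) * (counit y : k)).
Proof.
split=> [x1 x2 y|x y1 y2|x c y]; rewrite ?raddfD ?mulrDl ?mulrDr //.
by rewrite !linearZ /= mulrCA mulrA.
Qed.

Lemma tk_mul_pure (x x' : A) (y y' : B) :
  tk_mul (pure x y) (pure x' y') = pure (x * x') (y * y').
Proof.
by rewrite /tk_mul (tlift_pure (tk_mullP _)) (tlift_pure (tk_mulrP _ _)).
Qed.

Lemma tk_mulDl : left_distributive tk_mul +%R.
Proof. by move=> u v w; rewrite /tk_mul (tliftD (tk_mullP _)). Qed.

Lemma tk_mulDr : right_distributive tk_mul +%R.
Proof.
move=> u v w; move: u; apply: tens_eq_morph.
- by move=> u u'; rewrite tk_mulDl.
- by move=> u u'; rewrite !tk_mulDl addrACA.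
- move=> x y; rewrite /tk_mul !(tlift_pure (tk_mullP _)).
  exact: (tliftD (tk_mulrP x y) v w).
Qed.

Lemma tk_mulA : associative tk_mul.
Proof.
move=> u v w; move: u; apply: tens_eq_morph.
- by move=> u u'; rewrite tk_mulDl.
- by move=> u u'; rewrite !tk_mulDl.
move=> x y; move: v; apply: tens_eq_morph.
- by move=> v v'; rewrite tk_mulDl tk_mulDr.
- by move=> v v'; rewrite tk_mulDr tk_mulDl.
move=> x' y'; move: w; apply: tens_eq_morph.
- by move=> w w'; rewrite !tk_mulDr.
- by move=> w w'; rewrite !tk_mulDr.
by move=> x'' y''; rewrite !tk_mul_pure !mulrA.
Qed.

Lemma tk_mul1 : left_id tk_one tk_mul.
Proof.
apply: tens_eq_morph => //; first by move=> u v; rewrite tk_mulDr.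
by move=> x y; rewrite tk_mul_pure !mul1r.
Qed.

Lemma tk_mulr1 : right_id tk_one tk_mul.
Proof.
apply: tens_eq_morph => //; first by move=> u v; rewrite tk_mulDl.
by move=> x y; rewrite tk_mul_pure !mulr1.
Qed.

Lemma tk_one_neq0 : tk_one != 0.
Proof.
apply/eqP=> /(congr1 tk_counit) /eqP.
rewrite /tk_counit (tlift_pure tk_counitP) !rmorph1 mulr1.
have -> : tlift (fun x y => (counit x : k) * (counit y : k)) (0 : AB) = 0.
  set F := tlift _; have FD := tliftD tk_counitP : {morph F : u v / u + v}.
  by apply: (addrI (F 0)); rewrite -FD !addr0.
by rewrite oner_eq0.
Qed.

HB.instance Definition _ := GRing.Zmodule_isNzRing.Build AB
  tk_mulA tk_mul1 tk_mulr1 tk_mulDl tk_mulDr tk_one_neq0.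

Lemma tk_scale_pure c x y : tk_scale c (pure x y) = pure (c *: x) y.
Proof. exact: tlift_pure (tk_scaleP c) _ _. Qed.

Lemma tk_scaleDr : right_distributive tk_scale +%R.
Proof. by move=> c; exact: tliftD (tk_scaleP c). Qed.

Lemma tk_scaleA a b (v : AB) : tk_scale a (tk_scale b v) = tk_scale (a * b) v.
Proof.
move: v; apply: tens_eq_morph => [u v|u v|x y]; rewrite ?tk_scaleDr //.
by rewrite !tk_scale_pure scalerA.
Qed.

Lemma tk_scale1 : left_id 1 tk_scale.
Proof.
apply: tens_eq_morph => [u v|u v|x y]; rewrite ?tk_scaleDr //.
by rewrite tk_scale_pure scale1r.
Qed.

Lemma tk_scaleDl (v : AB) : {morph tk_scale^~ v : a b / a + b}.
Proof.
move=> a b; move: v; apply: tens_eq_morph => [u v|u v|x y];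
  rewrite ?tk_scaleDr //; first exact: addrACA.
by rewrite !tk_scale_pure scalerDl pureDl.
Qed.

HB.instance Definition _ := GRing.Zmodule_isLmodule.Build k AB
  tk_scaleA tk_scale1 tk_scaleDr tk_scaleDl.

Lemma tk_scaleAl (c : k) (u v : AB) : c *: (u * v) = (c *: u) * v.
Proof.
move: u; apply: tens_eq_morph.
- by move=> u u'; rewrite mulrDl scalerDr.
- by move=> u u'; rewrite scalerDr mulrDl.
move=> x y; move: v; apply: tens_eq_morph.
- by move=> v v'; rewrite mulrDr scalerDr.
- by move=> v v'; rewrite mulrDr.
move=> x' y'; rewrite -[LHS]/(tk_scale c (tk_mul _ _)).
rewrite -[RHS]/(tk_mul (tk_scale c _) _).
by rewrite !(tk_mul_pure, tk_scale_pure) scalerAl.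
Qed.

HB.instance Definition _ := GRing.Lmodule_isLalgebra.Build k AB tk_scaleAl.

Lemma tk_scaleAr (c : k) (u v : AB) : c *: (u * v) = u * (c *: v).
Proof.
move: u; apply: tens_eq_morph.
- by move=> u u'; rewrite mulrDl scalerDr.
- by move=> u u'; rewrite mulrDl.
move=> x y; move: v; apply: tens_eq_morph.
- by move=> v v'; rewrite mulrDr scalerDr.
- by move=> v v'; rewrite scalerDr mulrDr.
move=> x' y'; rewrite -[LHS]/(tk_scale c (tk_mul _ _)).
rewrite -[RHS]/(tk_mul _ (tk_scale c _)).
by rewrite !(tk_mul_pure, tk_scale_pure) scalerAr.
Qed.

HB.instance Definition _ := GRing.Lalgebra_isAlgebra.Build k AB tk_scaleAr.

Fact tk_counit_linear : linear (tk_counit : AB -> k^o).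
Proof.
move=> c u v; rewrite /tk_counit (tliftD tk_counitP); congr (_ + _).
move: u; apply: tens_eq_morph.
- by move=> u u'; rewrite scalerDr (tliftD tk_counitP).
- by move=> u u'; rewrite (tliftD tk_counitP) scalerDr.
move=> x y; rewrite -[c *: _]/(tk_scale c _) tk_scale_pure.
by rewrite !(tlift_pure tk_counitP) linearZ /= -mulrA.
Qed.

Fact tk_counit_monoid : monoid_morphism (tk_counit : AB -> k^o).
Proof.
split; first by rewrite /tk_counit (tlift_pure tk_counitP) !rmorph1 mulr1.
move=> u v; move: u; apply: tens_eq_morph.
- by move=> u u'; rewrite mulrDl /tk_counit (tliftD tk_counitP).
- by move=> u u'; rewrite /tk_counit (tliftD tk_counitP) mulrDl.
move=> x y; move: v; apply: tens_eq_morph.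
- by move=> v v'; rewrite mulrDr /tk_counit (tliftD tk_counitP).
- by move=> v v'; rewrite /tk_counit (tliftD tk_counitP) mulrDr.
move=> x' y'; rewrite -[LHS]/(tk_counit (tk_mul (pure x y) (pure x' y'))) tk_mul_pure.
by rewrite /tk_counit !(tlift_pure tk_counitP) !rmorphM mulrACA.
Qed.

HB.instance Definition _ :=
  GRing.isLinear.Build k AB k^o _ tk_counit tk_counit_linear.
HB.instance Definition _ :=
  GRing.isMonoidMorphism.Build AB k^o tk_counit tk_counit_monoid.
HB.instance Definition _ :=
  isAugmented.Build k AB (tk_counit : {lrmorphism AB -> k^o}).

End TensorAlgebra.

Section TensorMaps.
Variables (k : fieldType) (A B C D : augAlgType k).

Definition tk_map (f : A -> C) (g : B -> D) (t : tensk A B) : tensk C D :=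
  tlift (fun x y => pure (f x) (g y)) t.

Definition tk_swap (t : tensk A B) : tensk B A := tlift (fun x y => pure y x) t.

Definition tk_assoc (t : tensk A (tensk B C)) : tensk (tensk A B) C :=
  tlift (fun x (u : tensk B C) =>
    tlift (fun y z => pure (pure x y : tensk A B) z) u) t.

End TensorMaps.

HB.mixin Record isCocommHopf (k : fieldType) H of Augmented k H := {
  comul : {lrmorphism H -> tensk H H};
  antipode : {linear H -> H};
  comulA : forall h : H,
    tk_map comul id (comul h) = tk_assoc (tk_map id comul (comul h));
  counit_comull : forall h : H,
    tlift (fun x y => (counit x : k) *: y) (comul h) = h;
  counit_comulr : forall h : H,
    tlift (fun x y => (counit y : k) *: x) (comul h) = h;
  antipodel : forall h : H,
    tlift (fun x y => antipode x * y) (comul h) = (counit h : k)%:A;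
  antipoder : forall h : H,
    tlift (fun x y => x * antipode y) (comul h) = (counit h : k)%:A;
  comulC : forall h : H, tk_swap (comul h) = comul h
}.
#[short(type="cocommHopfType")]
HB.structure Definition CocommHopf (k : fieldType) :=
  {H of Augmented k H & isCocommHopf k H}.

(* A (x)_H Z, where H acts on A on the right through D : H -> A.              *)
Definition bchange (H A : pzRingType) (D : H -> A) (Z : lmodType H) :=
  tensor (fun (t : A) (h : H) => t * D h) Z.

Section BaseChange.
Variables (H A : pzRingType) (D : H -> A) (Z : lmodType H).
Local Notation AZ := (bchange D Z).

HB.instance Definition _ := GRing.Zmodule.on AZ.

Definition bc_scale (a : A) (u : AZ) : AZ :=
  tlift (fun t z => pure (a * t) z) u.

Fact bc_scaleP a : balanced (fun (t : A) (h : H) => t * D h)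
  (fun t (z : Z) => pure (a * t) z : AZ).
Proof.
split=> *; rewrite ?mulrDr ?pureDl ?pureDr //.
by rewrite mulrA -pure_bal.
Qed.

Lemma bc_scale_pure a t z : bc_scale a (pure t z) = pure (a * t) z.
Proof. exact: tlift_pure (bc_scaleP a) _ _. Qed.

Lemma bc_scaleDr : right_distributive bc_scale +%R.
Proof. by move=> a; exact: tliftD (bc_scaleP a). Qed.

Lemma bc_scaleA a b (v : AZ) : bc_scale a (bc_scale b v) = bc_scale (a * b) v.
Proof.
move: v; apply: tens_eq_morph => [u v|u v|x y]; rewrite ?bc_scaleDr //.
by rewrite !bc_scale_pure mulrA.
Qed.

Lemma bc_scale1 : left_id 1 bc_scale.
Proof.
apply: tens_eq_morph => [u v|u v|x y]; rewrite ?bc_scaleDr //.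
by rewrite bc_scale_pure mul1r.
Qed.

Lemma bc_scaleDl (v : AZ) : {morph bc_scale^~ v : a b / a + b}.
Proof.
move=> a b; move: v; apply: tens_eq_morph => [u v|u v|x y];
  rewrite ?bc_scaleDr //; first exact: addrACA.
by rewrite !bc_scale_pure mulrDl pureDl.
Qed.

HB.instance Definition _ := GRing.Zmodule_isLmodule.Build A AZ
  bc_scaleA bc_scale1 bc_scaleDr bc_scaleDl.
End BaseChange.

Section PseudoTensor.
Variables (k : fieldType) (H : cocommHopfType k).

Local Notation H2 := (tensk H H).
Local Notation H3 := (tensk (tensk H H) H).

Definition comul3 (h : H) : H3 := tk_map comul id (comul h).

(* H^{(x)2} (x)_H Z and H^{(x)3} (x)_H Z                                      *)
Definition P2 (Z : lmodType H) := bchange (comul : H -> H2) Z.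
Definition P3 (Z : lmodType H) := bchange comul3 Z.

HB.instance Definition _ (Z : lmodType H) := GRing.Lmodule.on (P2 Z).
HB.instance Definition _ (Z : lmodType H) := GRing.Lmodule.on (P3 Z).

(* id (x)_H f                                                                 *)
Definition pmap (X Y : lmodType H) (f : X -> Y) (w : P2 X) : P2 Y :=
  tlift (fun t x => pure t (f x)) w.

(* sigma_12 (x)_H 1                                                           *)
Definition sigma2 (Z : lmodType H) (w : P2 Z) : P2 Z :=
  tlift (fun (t : H2) z => pure (tk_swap t) z) w.
Definition sigma3 (Z : lmodType H) (w : P3 Z) : P3 Z :=
  tlift (fun (t : H3) z => pure (tk_map (@tk_swap k H H) id t) z) w.

(* a (x) b (x) c |-> b (x) c (x) a                                            *)
Definition rot3 (t : H3) : H3 :=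
  tlift (fun (ab : H2) c => tlift (fun a b => pure (pure b c : H2) a) ab) t.
(* sigma_{1 -> 3} (x)_H 1                                                     *)
Definition sigma13 (Z : lmodType H) (w : P3 Z) : P3 Z :=
  tlift (fun (t : H3) z => pure (rot3 t) z) w.

(* The elements of Hom_{H^{(x)2}}(X (x) Y, H^{(x)2} (x)_H Z); k-bilinearity is*)
(* the case f, g in k of the last clause.                                     *)
Definition pseudo_bilinear (X Y Z : lmodType H) (A : X -> Y -> P2 Z) :=
  [/\ forall x x' y, A (x + x') y = A x y + A x' y,
      forall x y y', A x (y + y') = A x y + A x y'
    & forall (f g : H) x y, A (f *: x) (g *: y) = (pure f g : H2) *: A x y].

Definition skew (X Z : lmodType H) (A : X -> X -> P2 Z) :=
  forall x y, A y x = - sigma2 (A x y).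

(* A(w, z) : w = t (x)_H e is sent to (t (x) 1) (Delta (x) id)(A(e, z)).      *)
Definition compl (X Y Z : lmodType H) (A : X -> Y -> P2 Z) (w : P2 X) (z : Y)
  : P3 Z :=
  tlift (fun (t : H2) e => (pure t 1 : H3) *:
    (tlift (fun (t' : H2) e' => pure (tk_map comul id t' : H3) e') (A e z)
      : P3 Z)) w.

(* A(x, w) : w = t (x)_H d is sent to (1 (x) t) (id (x) Delta)(A(x, d)).      *)
Definition compr (X Y Z : lmodType H) (A : X -> Y -> P2 Z) (x : X) (w : P2 Y)
  : P3 Z :=
  tlift (fun (t : H2) d => (tk_assoc (pure 1 t) : H3) *:
    (tlift (fun (t' : H2) d' => pure (tk_assoc (tk_map id comul t')) d') (A x d)
      : P3 Z)) w.

Section Pmap.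
Variables (X Y : lmodType H) (f : X -> Y).
Hypothesis f_lin : linear f.

Fact pmapP : balanced (fun (t : H2) (h : H) => t * comul h)
  (fun t (x : X) => pure t (f x) : P2 Y).
Proof.
split=> [t t' x|t x x'|t h x]; first exact: pureDl.
- by rewrite -[x]scale1r f_lin !scale1r pureDr.
- have f0 : f 0 = 0 by have /eqP := f_lin 1 0 0;
    rewrite !scale1r addr0 -subr_eq0 opprD addrA subrr sub0r oppr_eq0 => /eqP.
  by rewrite -[h *: x]addr0 f_lin f0 addr0 pure_bal.
Qed.

Lemma pmap_pure t x : pmap f (pure t x) = pure t (f x).
Proof. exact: tlift_pure pmapP _ _. Qed.

Lemma pmapD : {morph pmap f : u v / u + v}.
Proof. exact: tliftD pmapP. Qed.
End Pmap.

Lemma pmap_comp (X Y Z : lmodType H) (f : X -> Y) (g : Y -> Z) :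
  linear f -> linear g -> pmap (g \o f) =1 pmap g \o pmap f.
Proof.
move=> f_lin g_lin.
have gf_lin : linear (g \o f) by move=> a u v; rewrite /= f_lin g_lin.
apply: tens_eq_morph => [|u v|t x]; first exact: pmapD.
- by rewrite /= !pmapD.
- by rewrite /= !pmap_pure.
Qed.

Lemma pmap_id (X : lmodType H) : @pmap X X id =1 id.
Proof.
have id_lin : linear (@id X) by [].
by apply: tens_eq_morph => [||t x] //; [exact: pmapD | rewrite pmap_pure].
Qed.
End PseudoTensor.

HB.mixin Record isLiePseudo (k : fieldType) (H : cocommHopfType k) L
    of GRing.Lmodule H L := {
  pbr : L -> L -> P2 L;
  pbr_bilinear : pseudo_bilinear pbr;
  pbr_skew : skew pbr;
  pbr_jacobi : forall x y z : L,
    compl pbr (pbr x y) z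
      = compr pbr x (pbr y z) - sigma3 (compr pbr y (pbr x z))
}.
#[short(type="liePseudoType")]
HB.structure Definition LiePseudo (k : fieldType) (H : cocommHopfType k) :=
  {L of GRing.Lmodule H L & isLiePseudo k H L}.

Section Homomorphisms.
Variables (k : fieldType) (H : cocommHopfType k).

Definition lie_hom (X Y : liePseudoType H) (f : X -> Y) :=
  linear f /\ forall x y, pbr (f x) (f y) = pmap f (pbr x y).

Lemma lie_hom_id (X : liePseudoType H) : @lie_hom X X id.
Proof. by split=> // x y; rewrite pmap_id. Qed.

Lemma lie_hom_comp (X Y Z : liePseudoType H) (f : X -> Y) (g : Y -> Z) :
  lie_hom f -> lie_hom g -> lie_hom (g \o f).
Proof.
move=> [f_lin fM] [g_lin gM]; split=> [a u v|x y].
  by rewrite /= f_lin g_lin.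
by rewrite /= gM fM (pmap_comp f_lin g_lin).
Qed.

Lemma lie_hom_inv (X Y : liePseudoType H) (f : X -> Y) (g : Y -> X) :
  cancel f g -> cancel g f -> lie_hom f -> lie_hom g.
Proof.
move=> fK gK [f_lin fM].
have g_lin : linear g by move=> a u v; apply: (can_inj fK); rewrite f_lin !gK.
split=> // x y.
rewrite -[LHS](pmap_id (X := X)) -[in LHS](_ : g \o f = id); last first.
  by apply/funext => z /=; rewrite fK.
by rewrite (pmap_comp f_lin g_lin) /= -fM !gK.
Qed.

Section Aut.
Variable X : liePseudoType H.

Record aut := Aut {
  aut_fun :> X -> X;
  aut_hom : lie_hom aut_fun;
  aut_bij : bijective aut_fun }.

HB.instance Definition _ := gen_eqMixin aut.
HB.instance Definition _ := gen_choiceMixin aut.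

Lemma aut_ext (f g : aut) : f =1 g -> f = g.
Proof.
case: f g => [f f_hom f_bij] [g g_hom g_bij] /= /funext fg.
move: f_hom f_bij; rewrite fg => f_hom f_bij.
by congr Aut; exact: Prop_irrelevance.
Qed.

Definition aut_one := Aut (@lie_hom_id X) (Bijective (frefl id) (frefl id)).
Definition aut_mul (f g : aut) :=
  Aut (lie_hom_comp (aut_hom g) (aut_hom f)) (bij_comp (aut_bij f) (aut_bij g)).

Fact aut_inv_ex (f : aut) : exists g : X -> X, cancel f g /\ cancel g f.
Proof. by case: (aut_bij f) => g fK gK; exists g. Qed.
Definition aut_inv_fun (f : aut) := projT1 (cid (aut_inv_ex f)).
Lemma aut_funK (f : aut) : cancel f (aut_inv_fun f).
Proof. by case: (projT2 (cid (aut_inv_ex f))). Qed.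
Lemma aut_invK (f : aut) : cancel (aut_inv_fun f) f.
Proof. by case: (projT2 (cid (aut_inv_ex f))). Qed.

Definition aut_inv (f : aut) :=
  Aut (lie_hom_inv (aut_funK f) (aut_invK f) (aut_hom f))
      (Bijective (aut_invK f) (aut_funK f)).

Fact aut_mulA : associative aut_mul. Proof. by move=> f g h; exact: aut_ext. Qed.
Fact aut_mul1 : left_id aut_one aut_mul. Proof. by move=> f; exact: aut_ext. Qed.
Fact aut_mulr1 : right_id aut_one aut_mul.
Proof. by move=> f; exact: aut_ext. Qed.
Fact aut_mulV : left_inverse aut_one aut_inv aut_mul.
Proof. by move=> f; apply: aut_ext => x; exact: aut_funK. Qed.
Fact aut_mulrV : right_inverse aut_one aut_inv aut_mul.
Proof. by move=> f; apply: aut_ext => x; exact: aut_invK. Qed.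

HB.instance Definition _ :=
  isGroup.Build aut aut_mulA aut_mul1 aut_mulr1 aut_mulV aut_mulrV.
End Aut.
End Homomorphisms.

Section Extension.
Variables (k : fieldType) (H : cocommHopfType k) (M E L : liePseudoType H).
Local Open Scope classical_set_scope.

Record nab_ext := NabExt {
  ext_i : M -> E;
  ext_p : E -> L;
  ext_i_hom : lie_hom ext_i;
  ext_p_hom : lie_hom ext_p;
  ext_i_inj : injective ext_i;
  ext_exact : range ext_i = ext_p @^-1` [set 0];
  ext_p_surj : range ext_p = [set: L] }.

Variable X : nab_ext.
Local Notation i := (ext_i X).
Local Notation p := (ext_p X).

Record ext_section := ExtSection {
  sec_fun :> L -> E;
  sec_linear : linear sec_fun;
  sec_p : cancel sec_fun p }.

(* The inverse of i on i(M), by which i(M) is identified with M.              *)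
Definition ext_pre (e : E) : M := xget 0 [set u | i u = e].

Lemma ext_preK : cancel i ext_pre.
Proof.
move=> u; apply: (@ext_i_inj X); rewrite /ext_pre.
by apply: (xgetPex 0 (P := [set v | i v = i u])); exists u.
Qed.

Lemma ext_preP e : range i e -> i (ext_pre e) = e.
Proof. by case=> u _ <-; rewrite ext_preK. Qed.

Lemma ext_iN u v : i (u - v) = i u - i v.
Proof.
have [i_lin _] := ext_i_hom X.
by rewrite addrC -scaleN1r i_lin scaleN1r addrC.
Qed.

Lemma ext_pN u v : p (u - v) = p u - p v.
Proof.
have [p_lin _] := ext_p_hom X.
by rewrite addrC -scaleN1r p_lin scaleN1r addrC.
Qed.

Lemma ext_p0 e : p e = 0 <-> range i e.
Proof. by rewrite ext_exact. Qed.

Lemma ext_p_ex x : exists e, p e = x.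
Proof.
have : range p x by rewrite ext_p_surj.
by case=> e _ <-; exists e.
Qed.

(* The condition is g(M) = M: for infinite-dimensional M the inclusion of g(M)*)
(* in M alone is not stable under inverses and does not make g|_M bijective.  *)
Definition AutM_pred : {pred aut E} :=
  fun g => `[< (fun e => g e) @` range i = range i >].

Fact AutM_group_closed : group_closed AutM_pred.
Proof.
split=> [|f g /asboolP fM /asboolP gM]; apply/asboolP.
  by rewrite image_id.
have fgE e : (f / g)%g e = f (aut_inv_fun g e) by [].
have fP e : range i e -> range i (f e) by move=> eM; rewrite -fM; exists e.
have gP e : range i e -> range i (g e) by move=> eM; rewrite -gM; exists e.
apply/seteqP; split=> [_ [e eM <-]|e eM].
  have [e' e'M <-] : [set g x | x in range i] e by rewrite gM.
  by rewrite fgE aut_funK; exact: fP.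
have [e' e'M <-] : [set f x | x in range i] e by rewrite fM.
by exists (g e'); [exact: gP | rewrite fgE aut_funK].
Qed.

Record AutM := MkAutM { AutM_val : aut E; _ : AutM_val \in AutM_pred }.
HB.instance Definition _ := [isSub for AutM_val].
HB.instance Definition _ := [Choice of AutM by <:].
HB.instance Definition _ :=
  SubChoice_isSubGroup.Build (aut E) AutM_pred AutM AutM_group_closed.

Lemma AutMP (g : AutM) e : range i (val g e) <-> range i e.
Proof.
have /asboolP gM := valP g; split=> [h|h]; last by rewrite -gM; exists e.
move: h; rewrite -{1}gM => -[e' e'M /= ge].
by have [h hK _] := aut_bij (val g); rewrite -(can_inj hK ge).
Qed.

Section Tau.
Variable (s : ext_section).

Definition restr_fun (g : AutM) (u : M) : M := ext_pre (val g (i u)).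
Definition quo_fun (g : AutM) (x : L) : L := p (val g (s x)).

Lemma restr_funE g u : i (restr_fun g u) = val g (i u).
Proof. by apply: ext_preP; apply/AutMP; exists u. Qed.

Lemma sec_pre e : i (ext_pre (e - s (p e))) = e - s (p e).
Proof. by apply/ext_preP/ext_p0; rewrite ext_pN sec_p subrr. Qed.

Lemma quo_funE g e : quo_fun g (p e) = p (val g e).
Proof.
have [g_lin _] := aut_hom (val g).
apply/eqP; rewrite -subr_eq0 -ext_pN.
have -> : val g (s (p e)) - val g e = val g (i (- ext_pre (e - s (p e)))).
  rewrite -[- ext_pre _]sub0r ext_iN sec_pre.
  have -> : i 0 = 0 by rewrite -(subrr 0) ext_iN subrr.
  rewrite sub0r opprB.
  by rewrite [LHS]addrC -[X in X + _]scaleN1r -g_lin scaleN1r addrC.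
by apply/eqP/ext_p0/AutMP; exists (- ext_pre (e - s (p e))).
Qed.

Definition sec_retr (e : E) : M := ext_pre (e - s (p e)).

Lemma sec_retr_linear : linear sec_retr.
Proof.
have [[i_lin _] [p_lin _]] := (ext_i_hom X, ext_p_hom X).
move=> a e e'; apply: (@ext_i_inj X).
rewrite i_lin !sec_pre p_lin (sec_linear s) scalerBr opprD.
exact: addrACA.
Qed.

Lemma sec_retrK : cancel i sec_retr.
Proof.
move=> w; rewrite /sec_retr (_ : p (i w) = 0); last by apply/ext_p0; exists w.
have -> : s 0 = 0.
  by have := sec_linear s (-1) 0 0; rewrite !scaleN1r oppr0 addr0 addNr.
by rewrite subr0 ext_preK.
Qed.

Lemma pmap_i_inj : injective (pmap i).
Proof.
have [i_lin _] := ext_i_hom X.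
apply: (can_inj (g := pmap sec_retr)) => w.
rewrite -[LHS]/((pmap sec_retr \o pmap i) w) -(pmap_comp i_lin sec_retr_linear).
by rewrite (_ : _ \o _ = id) ?pmap_id //; apply/funext => u; exact: sec_retrK.
Qed.

Lemma pmap_i_range w : pmap p w = 0 -> exists v, pmap i v = w.
Proof.
have [[i_lin _] [p_lin _]] := (ext_i_hom X, ext_p_hom X).
have dec v : pmap i (pmap sec_retr v) + pmap s (pmap p v) = v.
  move: v; apply: tens_eq_morph => // [u v|t e].
    by rewrite !(pmapD sec_retr_linear, pmapD i_lin, pmapD p_lin,
                 pmapD (sec_linear s)) addrACA.
  rewrite !(pmap_pure sec_retr_linear, pmap_pure i_lin, pmap_pure p_lin,
            pmap_pure (sec_linear s)) -pureDr.
  by rewrite sec_pre subrK.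
move=> w0; exists (pmap sec_retr w); rewrite -[RHS]dec w0.
have -> : pmap s (0 : P2 L) = 0; last by rewrite addr0.
by apply: (addrI (pmap s (0 : P2 L))); rewrite -(pmapD (sec_linear s)) !addr0.
Qed.

Fact restr_hom g : lie_hom (restr_fun g).
Proof.
have [g_lin gM] := aut_hom (val g); have [i_lin iM] := ext_i_hom X.
have r_lin : linear (restr_fun g).
  move=> a u v; apply: (@ext_i_inj X).
  by rewrite i_lin !restr_funE i_lin g_lin.
split=> // u v.
apply: pmap_i_inj.
rewrite -iM !restr_funE gM iM.
rewrite -[LHS]/((pmap (val g) \o pmap i) _) -[RHS]/((pmap i \o pmap _) _).
rewrite -!pmap_comp //; congr (pmap _ _); apply/funext => w /=.
by rewrite restr_funE.
Qed.

Fact quo_hom g : lie_hom (quo_fun g).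
Proof.
have [g_lin gM] := aut_hom (val g); have [p_lin pM] := ext_p_hom X.
have q_lin : linear (quo_fun g).
  by move=> a x y; rewrite /quo_fun (sec_linear s) g_lin p_lin.
split=> // x y.
have [[e <-] [e' <-]] := (ext_p_ex x, ext_p_ex y).
rewrite !quo_funE pM gM pM.
rewrite -[LHS]/((pmap p \o pmap (val g)) _) -[RHS]/((pmap _ \o pmap p) _).
rewrite -!pmap_comp //; congr (pmap _ _); apply/funext => z /=.
by rewrite quo_funE.
Qed.

Fact restr_bij g : bijective (restr_fun g).
Proof.
have VK e : val (g^-1)%g (val g e) = e by exact: aut_funK.
have KV e : val g (val (g^-1)%g e) = e by exact: aut_invK.
exists (restr_fun (g^-1)%g) => u; apply: (@ext_i_inj X).
  by rewrite !restr_funE VK.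
by rewrite !restr_funE KV.
Qed.

Fact quo_bij g : bijective (quo_fun g).
Proof.
have VK e : val (g^-1)%g (val g e) = e by exact: aut_funK.
have KV e : val g (val (g^-1)%g e) = e by exact: aut_invK.
exists (quo_fun (g^-1)%g) => x.
  by rewrite /(quo_fun g) quo_funE VK sec_p.
by rewrite /(quo_fun (g^-1)%g) quo_funE KV sec_p.
Qed.

Definition tau (g : AutM) : aut M * aut L :=
  (Aut (restr_hom g) (restr_bij g), Aut (quo_hom g) (quo_bij g)).

Fact tau_morphism : {morph tau : f g / (f / g)%g}.
Proof.
have tau1 : tau 1%g = 1%g.
  congr (_, _); apply: aut_ext => x /=; last exact: sec_p.
  by apply: (@ext_i_inj X); rewrite restr_funE.
have tauM f g : tau (f * g)%g = (tau f * tau g)%g.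
  congr (_, _); apply: aut_ext => x /=; last exact: (esym (quo_funE f _)).
  by apply: (@ext_i_inj X); rewrite !restr_funE.
by move=> f g; apply: (mulIg (tau g)); rewrite -tauM !mulgVK.
Qed.
HB.instance Definition _ :=
  isGroupMorphism.Build AutM (aut M * aut L)%type tau tau_morphism.

Definition AutML_pred : {pred AutM} := fun g => tau g == 1%g.

Fact AutML_group_closed : group_closed AutML_pred.
Proof.
split=> [|f g]; rewrite !unfold_in; first by rewrite gmulf1.
by move=> /eqP f1 /eqP g1; rewrite tau_morphism f1 g1 divg1.
Qed.

Record AutML := MkAutML { AutML_incl : AutM; _ : AutML_incl \in AutML_pred }.
HB.instance Definition _ := [isSub for AutML_incl].
HB.instance Definition _ := [Choice of AutML by <:].
HB.instance Definition _ :=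
  SubChoice_isSubGroup.Build AutM AutML_pred AutML AutML_group_closed.

(* H^{(x)2} (x)_H M is identified with its image under id (x)_H i, which is   *)
(* injective (pmap_i_inj); see chiE and psiE.                                 *)
Definition pmap_i_pre (w : P2 E) : P2 M := xget 0 [set v | pmap i v = w].

Definition chi (x y : L) : P2 M :=
  pmap_i_pre (pbr (s x) (s y) - pmap s (pbr x y)).
Definition psi (x : L) (u : M) : P2 M := pmap_i_pre (pbr (s x) (i u)).

Lemma chiE x y : pmap i (chi x y) = pbr (s x) (s y) - pmap s (pbr x y).
Proof.
have [p_lin pM] := ext_p_hom X.
rewrite /chi /pmap_i_pre.
apply: (xgetPex 0 (P := [set v | pmap i v = _])).
apply: pmap_i_range.
have pB u v : pmap p (u - v) = pmap p u - pmap p v.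
  by apply: (addIr (pmap p v)); rewrite -(pmapD p_lin) !subrK.
rewrite pB -pM !sec_p -[X in _ - X]/((pmap p \o pmap s) _).
rewrite -(pmap_comp (sec_linear s) p_lin) (_ : _ \o _ = id).
  by rewrite pmap_id subrr.
by apply/funext => z; exact: sec_p.
Qed.

Lemma psiE x u : pmap i (psi x u) = pbr (s x) (i u).
Proof.
have [p_lin pM] := ext_p_hom X.
rewrite /psi /pmap_i_pre; apply: (xgetPex 0 (P := [set v | pmap i v = _])).
apply: pmap_i_range; rewrite -pM (_ : p (i u) = 0); last first.
  by apply/ext_p0; exists u.
have [_ addr _] := @pbr_bilinear k H L.
by apply: (addrI (pbr (p (s x)) 0)); rewrite -addr !addr0.
Qed.

End Tau.
End Extension.

Section Cohomology.
Variables (k : fieldType) (H : cocommHopfType k) (L M : liePseudoType H).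
Local Open Scope classical_set_scope.

Definition cochain : zmodType := ((L -> L -> P2 M) * (L -> M -> P2 M))%type.

Definition nab_cocycle (c : cochain) :=
  let chi := c.1 in let psi := c.2 in
  [/\ pseudo_bilinear chi, skew chi, pseudo_bilinear psi
    & forall (x y z : L) (u v : M),
      [/\ compl pbr (psi x u) v
            = compr psi x (pbr u v) - sigma3 (compr pbr u (psi x v)),
          compr psi x (psi y u) - sigma3 (compr psi y (psi x u))
              - compl psi (pbr x y) u
            = compl pbr (chi x y) u
        & compr psi x (chi y z) - sigma3 (compr psi y (chi x z))
            + sigma13 (compr psi z (chi x y))
            + compr chi x (pbr y z) - sigma3 (compr chi y (pbr x z))
            + sigma13 (compr chi z (pbr x y)) = 0]].

Definition nab_equiv (c c' : cochain) :=
  let (chi, psi) := c in let (chi', psi') := c' in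
  exists phi : L -> M, [/\ linear phi,
    forall x u, psi x u - psi' x u = pbr (phi x) u
  & forall x y, chi x y - chi' x y
      = psi' x (phi y) - sigma2 (psi' y (phi x)) - pmap phi (pbr x y)
        + pbr (phi x) (phi y)].

(* The difference of two cocycles is in general not a cocycle, and comparing  *)
(* it with (0, 0) by nab_equiv does not compare the two cocycles: differences *)
(* have to be taken relative to a base cocycle b.  The class of d relative to *)
(* b consists of the d' such that b + d' is a cocycle equivalent to b + d.    *)
(* For b = 0 one gets the classes forming H^2_nab(L, M); in general translation*)
(* by b turns classes relative to b into classes forming H^2_nab(L, M), and   *)
(* the class of 0 into the class of b.                                        *)
Definition nab_class (b d : cochain) : set cochain :=
  [set d' | nab_cocycle (b + d') /\ nab_equiv (b + d) (b + d')].

Definition H2nab (b : cochain) : set (set cochain) :=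
  [set nab_class b d | d in [set d | nab_cocycle (b + d)]].
End Cohomology.

Section Wells.
Variables (k : fieldType) (H : cocommHopfType k) (M E L : liePseudoType H).
Variables (X : nab_ext M E L) (s : ext_section X).

Definition sec_cocycle : cochain L M := (chi s, psi s).

Definition act_cocycle (g : aut M * aut L) (c : cochain L M) : cochain L M :=
  let (beta, alpha) := g in
  (fun x y => pmap beta (c.1 ((alpha^-1)%g x) ((alpha^-1)%g y)),
   fun x u => pmap beta (c.2 ((alpha^-1)%g x) ((beta^-1)%g u))).

Definition wells (g : aut M * aut L) : set (cochain L M) :=
  nab_class sec_cocycle (act_cocycle g sec_cocycle - sec_cocycle).
End Wells.

(* Main.v *)
(* Write (b, a) for the pair of automorphisms.  Twisting the extension to
   M --(i b^-1)--> E --(a p)--> L, with section s a^-1, turns the cocycle of s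
   into its translate by (b, a).  Two facts then give exactness at
   Aut(M) x Aut(L).  The cochains equivalent to the cocycle of a section are
   exactly the cocycles of the other sections of the same extension, the map phi
   of the equivalence being the difference of the sections.  Sections t, t' of
   two extensions E, E' have equal cocycles if and only if the linear bijection
   E' -> E sending i' u + t' x to i u + t x is a homomorphism.  So (b, a) is in
   the kernel of the Wells map iff the twisted extension has a section with the
   cocycle of s, iff there is an automorphism g of E with g i = i b and
   p g = a p. *)

Require Import Defs.
From mathcomp Require Import all_boot all_order all_algebra.
From mathcomp Require Import boolp classical_sets functions.

Set Implicit Arguments.
Unset Strict Implicit.
Unset Printing Implicit Defensive.

Import GRing.Theory.
Local Open Scope ring_scope.

Local Notation pmap := Defs.pmap.
Local Notation skew := Defs.skew.

Section LinearPredicate.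
Variables (R : pzRingType) (U V : lmodType R) (f : U -> V).
Hypothesis f_lin : linear f.

Lemma linear_addE : {morph f : u v / u + v}.
Proof. by move=> u v; rewrite -[u]scale1r f_lin !scale1r. Qed.

Lemma linear_0E : f 0 = 0.
Proof. by apply: (addrI (f 0)); rewrite -linear_addE !addr0. Qed.

Lemma linear_oppE : {morph f : u / - u}.
Proof. by move=> u; rewrite -!scaleN1r (scalable_linear f_lin). Qed.

End LinearPredicate.

Lemma tens_eq_morph2 (R R' : pzRingType) (T T' : zmodType)
    (ract : T -> R -> T) (ract' : T' -> R' -> T') (Z : lmodType R)
    (Z' : lmodType R') (V : zmodType)
    (f g : tensor ract Z -> tensor ract' Z' -> V) :
    (forall v, {morph f^~ v : u u' / u + u'}) ->
    (forall u, {morph f u : v v' / v + v'}) ->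
    (forall v, {morph g^~ v : u u' / u + u'}) ->
    (forall u, {morph g u : v v' / v + v'}) ->
    (forall x z x' z', f (pure x z) (pure x' z') = g (pure x z) (pure x' z')) ->
  f =2 g.
Proof.
move=> fDl fDr gDl gDr fg u v; move: u; apply: tens_eq_morph => // x z.
by move: v; apply: tens_eq_morph.
Qed.

Section TensorK.
Variables (k : fieldType) (A B : augAlgType k).

Lemma tk_scalel (c : k) (x : A) (y : B) :
  pure (c *: x) y = c *: (pure x y : tensk A B).
Proof. by rewrite -[RHS]/(tk_scale c _) tk_scale_pure. Qed.

Lemma tk_scaler (c : k) (x : A) (y : B) :
  pure x (c *: y) = c *: (pure x y : tensk A B).
Proof. by rewrite -tk_scalel -pure_bal. Qed.

Lemma tk_pureM (x x' : A) (y y' : B) :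
  pure (x * x') (y * y') = (pure x y : tensk A B) * pure x' y'.
Proof. by rewrite -[RHS]/(tk_mul _ _) tk_mul_pure. Qed.

Lemma tk_ext_linear (V : lmodType k) (f : tensk A B -> V) :
  {morph f : u v / u + v} ->
  (forall c x y, f (c *: (pure x y : tensk A B)) = c *: f (pure x y)) ->
  linear f.
Proof.
move=> fD fZ c u v; rewrite fD; congr (_ + _).
move: u; apply: tens_eq_morph => [u u'|u u'|x y] //; rewrite ?scalerDr fD //.
by rewrite scalerDr.
Qed.

Lemma tk_ext_mul (R : pzRingType) (f : tensk A B -> R) :
  {morph f : u v / u + v} ->
  (forall x y x' y',
     f ((pure x y : tensk A B) * pure x' y') = f (pure x y) * f (pure x' y')) ->
  {morph f : u v / u * v}.
Proof.
move=> fD fM; apply: tens_eq_morph2 => // [v u u'|u v v'|v u u'|u v v'];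
  by rewrite ?(mulrDl, mulrDr, fD).
Qed.

End TensorK.

Section TensorKMaps.
Variables (k : fieldType) (A B C D : augAlgType k).

Section Map.
Variables (f : A -> C) (g : B -> D).
Hypotheses (f_lin : linear f) (g_lin : linear g).

Let fD u v : f (u + v) = f u + f v.
Proof. by rewrite -[u]scale1r f_lin !scale1r. Qed.
Let gD u v : g (u + v) = g u + g v.
Proof. by rewrite -[u]scale1r g_lin !scale1r. Qed.

Lemma tk_map_balanced : balanced (fun (x : A) (c : k) => c *: x)
  (fun x y => pure (f x) (g y) : tensk C D).
Proof.
split=> [x x' y|x y y'|x c y]; rewrite ?fD ?gD ?pureDl ?pureDr //.
by rewrite (scalable_linear f_lin) (scalable_linear g_lin) tk_scalel tk_scaler.
Qed.

Lemma tk_map_pure x y : tk_map f g (pure x y) = pure (f x) (g y).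
Proof. exact: tlift_pure tk_map_balanced _ _. Qed.

Lemma tk_mapD : {morph tk_map f g : u v / u + v}.
Proof. exact: tliftD tk_map_balanced. Qed.

Hypotheses (fM : monoid_morphism f) (gM : monoid_morphism g).

Lemma tk_map_monoid : monoid_morphism (tk_map f g).
Proof.
split; first by rewrite -[1]/(pure 1 1 : tensk A B) tk_map_pure fM gM.
apply: tk_ext_mul => [|x y x' y']; first exact: tk_mapD.
by rewrite -tk_pureM !tk_map_pure fM gM tk_pureM.
Qed.
End Map.

Lemma tk_swap_balanced : balanced (fun (x : A) (c : k) => c *: x)
  (fun x y => pure y x : tensk B A).
Proof.
split=> [x x' y|x y y'|x c y]; rewrite ?pureDl ?pureDr //.
by rewrite tk_scalel tk_scaler.
Qed.

Lemma tk_swap_pure x y : @tk_swap k A B (pure x y) = pure y x.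
Proof. exact: tlift_pure tk_swap_balanced _ _. Qed.

Lemma tk_swapD : {morph @tk_swap k A B : u v / u + v}.
Proof. exact: tliftD tk_swap_balanced. Qed.

Lemma tk_swap_linear : linear (@tk_swap k A B).
Proof.
apply: tk_ext_linear; first exact: tk_swapD.
by move=> c x y; rewrite -tk_scalel !tk_swap_pure tk_scaler.
Qed.

Lemma tk_swap_monoid : monoid_morphism (@tk_swap k A B).
Proof.
split; first exact: tk_swap_pure.
apply: tk_ext_mul => [|x y x' y']; first exact: tk_swapD.
by rewrite -tk_pureM !tk_swap_pure tk_pureM.
Qed.

Lemma tk_assoc_balanced_in (x : A) : balanced (fun (y : B) (c : k) => c *: y)
  (fun y z => pure (pure x y : tensk A B) z : tensk (tensk A B) C).
Proof.
split=> [y y' z|y z z'|y c z]; rewrite ?pureDr ?pureDl //.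
by rewrite tk_scaler tk_scalel tk_scaler.
Qed.

Lemma tk_assoc_balanced : balanced (fun (x : A) (c : k) => c *: x)
  (fun x (u : tensk B C) =>
    tlift (fun y z => pure (pure x y : tensk A B) z : tensk (tensk A B) C) u).
Proof.
have bal := tk_assoc_balanced_in.
split=> [x x' u|x u u'|x c u].
- move: u; apply: tens_eq_morph => [u v|u v|y z].
  + by rewrite (tliftD (bal _)).
  + by rewrite !(tliftD (bal _)) addrACA.
  + by rewrite !(tlift_pure (bal _)) !pureDl.
- exact: tliftD (bal _) _ _.
- move: u; apply: tens_eq_morph => [u v|u v|y z].
  + by rewrite (tliftD (bal _)).
  + by rewrite scalerDr !(tliftD (bal _)).
  + rewrite -tk_scalel !(tlift_pure (bal _)).
    by rewrite !tk_scaler !tk_scalel.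
Qed.

Lemma tk_assoc_pure x y z :
  @tk_assoc k A B C (pure x (pure y z : tensk B C)) =
    pure (pure x y : tensk A B) z.
Proof.
rewrite /tk_assoc (tlift_pure tk_assoc_balanced).
exact: (tlift_pure (tk_assoc_balanced_in x)).
Qed.

Lemma tk_assocD : {morph @tk_assoc k A B C : u v / u + v}.
Proof. exact: tliftD tk_assoc_balanced. Qed.

Lemma tk_assoc_monoid : monoid_morphism (@tk_assoc k A B C).
Proof.
split; first exact: tk_assoc_pure.
apply: tk_ext_mul => [|x u x' u']; first exact: tk_assocD.
rewrite -tk_pureM; move: u u'.
apply: tens_eq_morph2 => [v u u'|u v v'|v u u'|u v v'|y z y' z'];
  rewrite ?(mulrDl, mulrDr, pureDr, tk_assocD) //.
by rewrite -tk_pureM !tk_assoc_pure -!tk_pureM.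
Qed.

End TensorKMaps.

Section BaseChangeMap.
Variables (H A A' : pzRingType) (d : H -> A) (d' : H -> A').

(* [pmap], [sigma2], [sigma3], [sigma13] and the inner maps of [compl] and
   [compr] are all of this form, up to conversion. *)
Definition bmap (X Y : lmodType H) (phi : A -> A') (f : X -> Y)
    (w : bchange d X) : bchange d' Y :=
  tlift (fun t x => pure (phi t) (f x)) w.

Definition bmap_compat (phi : A -> A') :=
  [/\ {morph phi : a b / a + b}, {morph phi : a b / a * b}
    & forall h, phi (d h) = d' h].

End BaseChangeMap.
Arguments bmap {H A A' d d' X Y} phi f w.
Arguments bmap_compat {H A A'} d d' phi.

Lemma compat_id (H A : pzRingType) (d : H -> A) : bmap_compat d d id.
Proof. by []. Qed.

Section BaseChangeMapTheory.
Variables (H A A' : pzRingType) (d : H -> A) (d' : H -> A').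
Variables (X Y : lmodType H) (phi : A -> A') (f : X -> Y).
Local Notation bmap := (@bmap H A A' d d' X Y).
Hypotheses (phiP : bmap_compat d d' phi) (f_lin : linear f).

Lemma bmap_balanced : balanced (fun (t : A) (h : H) => t * d h)
  (fun t x => pure (phi t) (f x) : bchange d' Y).
Proof.
case: phiP => phiD phiM phid; split=> [t t' x|t x x'|t h x].
- by rewrite phiD pureDl.
- by rewrite -[x]scale1r f_lin !scale1r pureDr.
- by rewrite phiM phid (scalable_linear f_lin) -pure_bal.
Qed.

Lemma bmap_pure t x : bmap phi f (pure t x) = pure (phi t) (f x).
Proof. exact: tlift_pure bmap_balanced _ _. Qed.

Lemma bmapD : {morph bmap phi f : u v / u + v}.
Proof. exact: tliftD bmap_balanced. Qed.

Lemma bmap0 : bmap phi f 0 = 0.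
Proof. by apply: (addrI (bmap phi f 0)); rewrite -bmapD !addr0. Qed.

Lemma bmapN : {morph bmap phi f : u / - u}.
Proof.
by move=> u; apply: (addrI (bmap phi f u)); rewrite -bmapD !subrr bmap0.
Qed.

Lemma bmapB : {morph bmap phi f : u v / u - v}.
Proof. by move=> u v; rewrite bmapD bmapN. Qed.


End BaseChangeMapTheory.

Lemma bc_scaleE (H A : pzRingType) (d : H -> A) (X : lmodType H) a t (x : X) :
  a *: (pure t x : bchange d X) = pure (a * t) x.
Proof. exact: bc_scale_pure. Qed.

Lemma bmapZ (H A A' : pzRingType) (d : H -> A) (d' : H -> A')
    (X Y : lmodType H) (phi : A -> A') (f : X -> Y) :
  bmap_compat d d' phi -> linear f ->
  forall a (w : bchange d X),
    bmap phi f (a *: w) = phi a *: (bmap phi f w : bchange d' Y).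
Proof.
move=> phiP f_lin a; have [phiD phiM phid] := phiP.
apply: tens_eq_morph => [u v|u v|t x].
- by rewrite scalerDr bmapD.
- by rewrite bmapD // scalerDr.
- by rewrite bc_scaleE !bmap_pure // bc_scaleE phiM.
Qed.

Lemma bmap_comp (H A A' A'' : pzRingType) (d : H -> A) (d' : H -> A')
    (d'' : H -> A'') (X Y Z : lmodType H) (phi : A -> A') (psi : A' -> A'')
    (f : X -> Y) (g : Y -> Z) :
  bmap_compat d d' phi -> bmap_compat d' d'' psi -> linear f -> linear g ->
  forall w : bchange d X,
    bmap psi g (bmap phi f w : bchange d' Y) =
      (bmap (psi \o phi) (g \o f) w : bchange d'' Z).
Proof.
move=> phiP psiP f_lin g_lin.
have [[phiD phiM phid] [psiD psiM psid]] := (phiP, psiP).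
have cP : bmap_compat d d'' (psi \o phi).
  by split=> [a b|a b|h] /=; rewrite ?phiD ?phiM ?phid.
have gf_lin : linear (g \o f) by move=> a u v; rewrite /= f_lin g_lin.
apply: tens_eq_morph => [u v|u v|t x]; rewrite ?bmapD ?bmap_pure //.
Qed.

Section HopfMaps.
Variables (k : fieldType) (H : cocommHopfType k).
Local Notation H2 := (tensk H H).
Local Notation H3 := (tensk (tensk H H) H).

Definition comulL (t : H2) : H3 := tk_map comul id t.
Definition comulR (t : H2) : H3 := tk_assoc (tk_map id comul t).
Definition swap12 (t : H3) : H3 := tk_map (@tk_swap k H H) id t.

Let comul_lin : linear (comul : H -> H2) := linearP comul.
Let comul_mon : monoid_morphism (comul : H -> H2).
Proof. by split; [exact: rmorph1 | exact: rmorphM]. Qed.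
Let id_lin : linear (@id H). Proof. by []. Qed.
Let id_mon : monoid_morphism (@id H). Proof. by []. Qed.

Lemma swap_compat :
  bmap_compat (comul : H -> H2) (comul : H -> H2) (@tk_swap k H H).
Proof.
split; [exact: tk_swapD | exact: (tk_swap_monoid _ _).2 | exact: comulC].
Qed.

Lemma comulL_pure x y : comulL (pure x y) = pure (comul x) y.
Proof. exact: tk_map_pure. Qed.

Lemma comulLM : {morph comulL : u v / u * v}.
Proof. exact: (tk_map_monoid comul_lin id_lin comul_mon id_mon).2. Qed.

Lemma comulL_compat : bmap_compat (comul : H -> H2) (@comul3 k H) comulL.
Proof. by split=> //; [exact: tk_mapD | exact: comulLM]. Qed.

Lemma comulRM : {morph comulR : u v / u * v}.
Proof.
move=> u v; rewrite /comulR (tk_map_monoid id_lin comul_lin id_mon comul_mon).2.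
have [_ assocM] := @tk_assoc_monoid k H H H.
exact: assocM.
Qed.

Lemma comulR_compat : bmap_compat (comul : H -> H2) (@comul3 k H) comulR.
Proof.
split=> [u v|u v|h]; [|exact: comulRM|exact: esym (comulA h)].
rewrite /comulR (tk_mapD id_lin comul_lin); exact: (@tk_assocD k H H H).

Qed.

Lemma swap12_pure x y : swap12 (pure x y) = pure (tk_swap x) y.
Proof. by apply: tk_map_pure => //; exact: tk_swap_linear. Qed.

Lemma swap12_compat : bmap_compat (@comul3 k H) (@comul3 k H) swap12.
Proof.
split=> [||h].
- apply: tk_mapD => //; exact: tk_swap_linear.
- have swap_lin := @tk_swap_linear k H H.
  exact: (tk_map_monoid swap_lin id_lin (tk_swap_monoid _ _) id_mon).2.
- rewrite /comul3 -[tk_map comul id _]/(comulL _).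
  move: (comul h); apply: tens_eq_morph => [u v|u v|x y].
  + case: comulL_compat => LD _ _; rewrite LD.
    by apply: tk_mapD => //; exact: tk_swap_linear.
  + by case: comulL_compat => LD _ _; rewrite LD.
  + by rewrite comulL_pure swap12_pure comulC.
Qed.

Lemma rot3_balanced_in c : balanced (fun (x : H) (c : k) => c *: x)
  (fun a b : H => pure (pure b c : H2) a : H3).
Proof.
split=> [y y' z|y z z'|y a z]; rewrite ?pureDr ?pureDl //.
by rewrite tk_scaler !tk_scalel.
Qed.

Lemma rot3_balanced : balanced (fun (x : H2) (c : k) => c *: x)
  (fun (ab : H2) (c : H) => tlift (fun a b => pure (pure b c : H2) a : H3) ab).
Proof.
have bal := rot3_balanced_in.
split=> [u u' c|u c c'|u a c]; first exact: tliftD (bal _) _ _.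
- move: u; apply: tens_eq_morph => [u v|u v|y z].
  + by rewrite (tliftD (bal _)).
  + by rewrite !(tliftD (bal _)) addrACA.
  + by rewrite !(tlift_pure (bal _)) !(pureDr, pureDl).
- move: u; apply: tens_eq_morph => [u v|u v|y z].
  + by rewrite scalerDr !(tliftD (bal _)).
  + by rewrite !(tliftD (bal _)).
  + rewrite -tk_scalel !(tlift_pure (bal _)).
    by rewrite !tk_scaler !tk_scalel.
Qed.

Lemma rot3_pure a b c :
  rot3 (pure (pure a b : H2) c : H3) = pure (pure b c : H2) a.
Proof.
rewrite /rot3 (tlift_pure rot3_balanced).
exact: (tlift_pure (rot3_balanced_in c)).
Qed.

Lemma rot3D : {morph @rot3 k H : u v / u + v}.
Proof. exact: tliftD rot3_balanced. Qed.

Lemma rot3M : {morph @rot3 k H : u v / u * v}.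
Proof.
apply: tk_ext_mul => [|u x u' x']; first exact: rot3D.
rewrite -tk_pureM; move: u u'.
apply: tens_eq_morph2 => [v u u'|u v v'|v u u'|u v v'|y z y' z'];
  rewrite ?(mulrDl, mulrDr, pureDl, rot3D) //.
by rewrite -tk_pureM !rot3_pure -!tk_pureM.
Qed.

Let addD (U V W : zmodType) (f : U -> V) (g : V -> W) :
  {morph f : u v / u + v} -> {morph g : u v / u + v} ->
  {morph (g \o f) : u v / u + v}.
Proof. by move=> fD gD u v; rewrite /= fD gD. Qed.

Let assocD := @tk_assocD k H H H.
Let swapD := @tk_swapD k H H2.

Lemma rot3_assoc : @rot3 k H \o @tk_assoc k H H H =1 @tk_swap k H H2.
Proof.
apply: tens_eq_morph => [||x u]; [exact: addD assocD rot3D | exact: swapD|].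
rewrite tk_swap_pure /=; move: u.
have pD : {morph (fun u : H2 => pure x u : tensk H H2) : u v / u + v}.
  by move=> u v; rewrite pureDr.
apply: (@tens_eq_morph _ _ _ _ _ (@rot3 k H \o @tk_assoc k H H H \o _))
  => [||y z].
- exact: addD pD (addD assocD rot3D).
- by move=> u v; rewrite pureDl.
- by rewrite /= tk_assoc_pure rot3_pure.
Qed.

Lemma swap_map_comul (t : H2) :
  tk_swap (tk_map id comul t) = comulL (tk_swap t).
Proof.
have [LD _ _] := comulL_compat.
move: t; apply: (@tens_eq_morph _ _ _ _ _ (@tk_swap k H H2 \o _)
  (comulL \o @tk_swap k H H)) => [||x y] /=.
- exact: addD (tk_mapD id_lin comul_lin) swapD.
- exact: addD (@tk_swapD k H H) LD.
- by rewrite (tk_map_pure id_lin comul_lin) !tk_swap_pure comulL_pure.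
Qed.

Lemma rot3_comulR (t : H2) : rot3 (comulR t) = comulL (tk_swap t).
Proof. exact: etrans (rot3_assoc _) (swap_map_comul t). Qed.

Lemma rot3_compat : bmap_compat (@comul3 k H) (@comul3 k H) (@rot3 k H).
Proof.
split; [exact: rot3D | exact: rot3M | move=> h].
have [_ _ LE] := comulL_compat; have [_ _ RE] := comulR_compat.
by rewrite -[in LHS]RE rot3_comulR comulC LE.
Qed.

End HopfMaps.

Section Compositions.
Variables (k : fieldType) (H : cocommHopfType k).
Local Notation H2 := (tensk H H).
Local Notation H3 := (tensk (tensk H H) H).
Local Notation comul2 := (comul : H -> H2).

Definition embL (t : H2) : H3 := pure t 1.
Definition embR (t : H2) : H3 := tk_assoc (pure 1 t).

Lemma embLD : {morph embL : t u / t + u}.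
Proof. by move=> t u; rewrite /embL pureDl. Qed.

Lemma embLM : {morph embL : t u / t * u}.
Proof. by move=> t u; rewrite /embL -tk_pureM mulr1. Qed.

Lemma embL_comul h : embL (comul h) = comulL (pure h 1).
Proof. by rewrite comulL_pure. Qed.

Lemma embRD : {morph embR : t u / t + u}.
Proof. by move=> t u; rewrite /embR pureDr; exact: (@tk_assocD k H H H). Qed.

Lemma embRM : {morph embR : t u / t * u}.
Proof.
have [_ aM] := @tk_assoc_monoid k H H H.
move=> t u; rewrite -aM; congr tk_assoc.
by rewrite -tk_pureM mulr1.
Qed.

Lemma embR_comul h : embR (comul h) = comulR (pure 1 h).
Proof.
have c_lin : linear comul2 := linearP comul.
by rewrite /comulR tk_map_pure.
Qed.

Lemma rot3_embR t : rot3 (embR t) = embL t.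
Proof. exact: etrans (rot3_assoc _) (tk_swap_pure _ _). Qed.

Variables X Y Z : lmodType H.

Definition pmap3 (f : X -> Y) (w : P3 X) : P3 Y := bmap id f w.

Definition insL (w : P2 Z) : P3 Z := bmap (@comulL k H) id w.
Definition insR (w : P2 Z) : P3 Z := bmap (@comulR k H) id w.

Let id_lin : linear (@id Z). Proof. by []. Qed.

Lemma insLD : {morph insL : u v / u + v}.
Proof. exact: bmapD (comulL_compat H) id_lin. Qed.
Lemma insLN : {morph insL : u / - u}.
Proof. exact: bmapN (comulL_compat H) id_lin. Qed.
Lemma insRD : {morph insR : u v / u + v}.
Proof. exact: bmapD (comulR_compat H) id_lin. Qed.
Lemma insRN : {morph insR : u / - u}.
Proof. exact: bmapN (comulR_compat H) id_lin. Qed.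
Lemma insLZ a (w : P2 Z) : insL (a *: w) = comulL a *: insL w.
Proof. exact: (bmapZ (comulL_compat H) id_lin). Qed.
Lemma insRZ a (w : P2 Z) : insR (a *: w) = comulR a *: insR w.
Proof. exact: (bmapZ (comulR_compat H) id_lin). Qed.

Lemma sigma13_insR w : sigma13 (insR w) = insL (sigma2 w).
Proof.
rewrite -[sigma13 _]/(bmap (@rot3 k H) id _).
rewrite -[sigma2 _]/(bmap (@tk_swap k H H) id _).
rewrite /insL /insR.
rewrite (bmap_comp (comulR_compat H) (rot3_compat H) id_lin id_lin).
rewrite (bmap_comp (swap_compat H) (comulL_compat H) id_lin id_lin).
congr bmap; apply/funext => t /=; exact: rot3_comulR.
Qed.

Section Bilinear.
Variable A : X -> Y -> P2 Z.
Hypothesis A_bil : pseudo_bilinear A.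

Lemma pbilDl x x' y : A (x + x') y = A x y + A x' y. Proof. by case: A_bil. Qed.
Lemma pbilDr x y y' : A x (y + y') = A x y + A x y'. Proof. by case: A_bil. Qed.
Lemma pbilZl h x y : A (h *: x) y = (pure h 1 : H2) *: A x y.
Proof. by case: A_bil => _ _ <-; rewrite scale1r. Qed.
Lemma pbilZr h x y : A x (h *: y) = (pure 1 h : H2) *: A x y.
Proof. by case: A_bil => _ _ <-; rewrite scale1r. Qed.
Lemma pbil0l y : A 0 y = 0.
Proof. by apply: (addrI (A 0 y)); rewrite -pbilDl !addr0. Qed.
Lemma pbilNl x y : A (- x) y = - A x y.
Proof. by apply: (addrI (A x y)); rewrite -pbilDl !subrr pbil0l. Qed.
Lemma compl_balanced z : balanced (fun (t : H2) (h : H) => t * comul h)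
  (fun t e => embL t *: insL (A e z)).
Proof.
split=> [t t' e|t e e'|t h e].
- by rewrite embLD scalerDl.
- by rewrite pbilDl insLD scalerDr.
- by rewrite pbilZl insLZ scalerA -embL_comul embLM.
Qed.

Lemma compr_balanced x : balanced (fun (t : H2) (h : H) => t * comul h)
  (fun t d => embR t *: insR (A x d)).
Proof.
split=> [t t' e|t e e'|t h e].
- by rewrite embRD scalerDl.
- by rewrite pbilDr insRD scalerDr.
- by rewrite pbilZr insRZ scalerA -embR_comul embRM.
Qed.

Lemma compl_pure t e z : compl A (pure t e) z = embL t *: insL (A e z).
Proof. exact: (tlift_pure (compl_balanced z)). Qed.

Lemma complD z : {morph (fun w => compl A w z) : u v / u + v}.
Proof. exact: (tliftD (compl_balanced z)). Qed.

Lemma compr_pure t x d : compr A x (pure t d) = embR t *: insR (A x d).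
Proof. exact: (tlift_pure (compr_balanced x)). Qed.

Lemma comprD x : {morph compr A x : u v / u + v}.
Proof. exact: (tliftD (compr_balanced x)). Qed.

End Bilinear.
End Compositions.

Section Naturality.
Variables (k : fieldType) (H : cocommHopfType k).
Local Notation comul2 := (comul : H -> tensk H H).

Section Pmap.
Variables (X Y : lmodType H) (f : X -> Y).
Hypothesis f_lin : linear f.

Lemma pmapZ a (w : P2 X) : pmap f (a *: w) = a *: pmap f w.
Proof. exact: (bmapZ (@compat_id _ _ comul2) f_lin). Qed.
Lemma pmapN (w : P2 X) : pmap f (- w) = - pmap f w.
Proof. exact: (bmapN (@compat_id _ _ comul2) f_lin). Qed.
Lemma pmapB (v w : P2 X) : pmap f (v - w) = pmap f v - pmap f w.
Proof. exact: (bmapB (@compat_id _ _ comul2) f_lin). Qed.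
Lemma pmap3D : {morph pmap3 f : u v / u + v}.
Proof. exact: (bmapD (@compat_id _ _ (@comul3 k H)) f_lin). Qed.
Lemma pmap3Z a (w : P3 X) : pmap3 f (a *: w) = a *: pmap3 f w.
Proof. exact: (bmapZ (@compat_id _ _ (@comul3 k H)) f_lin). Qed.
Lemma pmap3N (w : P3 X) : pmap3 f (- w) = - pmap3 f w.
Proof. exact: (bmapN (@compat_id _ _ (@comul3 k H)) f_lin). Qed.
Lemma pmap3B (v w : P3 X) : pmap3 f (v - w) = pmap3 f v - pmap3 f w.
Proof. exact: (bmapB (@compat_id _ _ (@comul3 k H)) f_lin). Qed.

Let idX_lin : linear (@id X). Proof. by []. Qed.
Let idY_lin : linear (@id Y). Proof. by []. Qed.

Lemma pmap_sigma2 w : pmap f (sigma2 w) = sigma2 (pmap f w).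
Proof.
rewrite [LHS](bmap_comp (swap_compat H) (@compat_id _ _ _) idX_lin f_lin).
by rewrite [RHS](bmap_comp (@compat_id _ _ _) (swap_compat H) f_lin idY_lin).
Qed.

Lemma pmap3_sigma3 w : pmap3 f (sigma3 w) = sigma3 (pmap3 f w).
Proof.
rewrite [LHS](bmap_comp (swap12_compat H) (@compat_id _ _ _) idX_lin f_lin).
by rewrite [RHS](bmap_comp (@compat_id _ _ _) (swap12_compat H) f_lin idY_lin).
Qed.

Lemma pmap3_sigma13 w : pmap3 f (sigma13 w) = sigma13 (pmap3 f w).
Proof.
rewrite [LHS](bmap_comp (rot3_compat H) (@compat_id _ _ _) idX_lin f_lin).
by rewrite [RHS](bmap_comp (@compat_id _ _ _) (rot3_compat H) f_lin idY_lin).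
Qed.

Lemma pmap3_insL w : pmap3 f (insL w) = insL (pmap f w).
Proof.
rewrite [LHS](bmap_comp (comulL_compat H) (@compat_id _ _ _) idX_lin f_lin).
by rewrite [RHS](bmap_comp (@compat_id _ _ _) (comulL_compat H) f_lin idY_lin).
Qed.

Lemma pmap3_insR w : pmap3 f (insR w) = insR (pmap f w).
Proof.
rewrite [LHS](bmap_comp (comulR_compat H) (@compat_id _ _ _) idX_lin f_lin).
by rewrite [RHS](bmap_comp (@compat_id _ _ _) (comulR_compat H) f_lin idY_lin).
Qed.

Lemma pmap3_inj (g : Y -> X) : linear g -> cancel f g -> injective (pmap3 f).
Proof.
move=> g_lin fK; apply: (can_inj (g := pmap3 g)).
apply: tens_eq_morph => [u v||t x] //.
- rewrite pmap3D; exact: (bmapD (@compat_id _ _ (@comul3 k H)) g_lin).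
- rewrite [X in pmap3 _ X](bmap_pure (@compat_id _ _ _) f_lin).
  by rewrite [LHS](bmap_pure (@compat_id _ _ _) g_lin) fK.
Qed.
End Pmap.

Variable Z : lmodType H.
Let id_lin : linear (@id Z). Proof. by []. Qed.

Lemma sigma2B : {morph @sigma2 k H Z : u v / u - v}.
Proof. exact: bmapB (swap_compat H) id_lin. Qed.
Lemma sigma3B : {morph @sigma3 k H Z : u v / u - v}.
Proof. exact: bmapB (swap12_compat H) id_lin. Qed.
Lemma sigma3D : {morph @sigma3 k H Z : u v / u + v}.
Proof. exact: bmapD (swap12_compat H) id_lin. Qed.
Lemma sigma13D : {morph @sigma13 k H Z : u v / u + v}.
Proof. exact: bmapD (rot3_compat H) id_lin. Qed.
Lemma sigma13B : {morph @sigma13 k H Z : u v / u - v}.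
Proof. exact: bmapB (rot3_compat H) id_lin. Qed.
Lemma sigma13Z a (w : P3 Z) : sigma13 (a *: w) = rot3 a *: sigma13 w.
Proof. exact: (bmapZ (rot3_compat H) id_lin). Qed.
Lemma pmap_addf (X Y : lmodType H) (f g : X -> Y) : linear f -> linear g ->
  forall w, pmap (fun x => f x + g x) w = pmap f w + pmap g w.
Proof.
move=> f_lin g_lin; have fg_lin : linear (fun x => f x + g x).
  by move=> a u v; rewrite f_lin g_lin scalerDr addrACA.
apply: tens_eq_morph => [u v|u v|t x].
- exact: (pmapD fg_lin).
- by rewrite !pmapD // addrACA.
- by rewrite !pmap_pure // pureDr.
Qed.

Section Compositions.
Variables (X Y X' Y' Z' : lmodType H).
Variables (A : X -> Y -> P2 Z) (B : X' -> Y' -> P2 Z').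
Variables (f : X -> X') (f' : Y -> Y') (g : Z -> Z').
Hypotheses (A_bil : pseudo_bilinear A) (B_bil : pseudo_bilinear B).
Hypotheses (f_lin : linear f) (f'_lin : linear f') (g_lin : linear g).

Lemma compl_pmap (y : Y) (y' : Y') :
  (forall x, B (f x) y' = pmap g (A x y)) ->
  forall w, compl B (pmap f w) y' = pmap3 g (compl A w y).
Proof.
move=> AB; apply: tens_eq_morph => [u v|u v|t e].
- by rewrite pmapD // complD.
- by rewrite complD // pmap3D.
- by rewrite pmap_pure // !compl_pure // AB pmap3Z // pmap3_insL.
Qed.

Lemma compr_pmap (x : X) (x' : X') :
  (forall y, B x' (f' y) = pmap g (A x y)) ->
  forall w, compr B x' (pmap f' w) = pmap3 g (compr A x w).
Proof.
move=> AB; apply: tens_eq_morph => [u v|u v|t e].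
- by rewrite pmapD // comprD.
- by rewrite comprD // pmap3D.
- by rewrite pmap_pure // !compr_pure // AB pmap3Z // pmap3_insR.
Qed.
End Compositions.

Lemma sigma13_compr (X : lmodType H) (A : X -> X -> P2 Z) :
  pseudo_bilinear A -> skew A ->
  forall z w, sigma13 (compr A z w) = - compl A w z.
Proof.
move=> A_bil A_skew z; apply: tens_eq_morph => [u v|u v|t d].
- by rewrite comprD // sigma13D.
- by rewrite complD // opprD.
rewrite compr_pure // compl_pure // sigma13Z rot3_embR sigma13_insR.
rewrite (A_skew z d) -scalerN; congr (_ *: _).
by rewrite insLN opprK.
Qed.

End Naturality.

Section SectionCocycle.
Variables (k : fieldType) (H : cocommHopfType k) (M E L : liePseudoType H).
Variables (X : nab_ext M E L) (s : ext_section X).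
Local Notation i := (ext_i X).

Let i_lin : linear i := (ext_i_hom X).1.
Let iM : forall u v, pbr (i u) (i v) = pmap i (pbr u v) := (ext_i_hom X).2.
Let s_lin : linear s := sec_linear s.
Let M_bil := @pbr_bilinear k H M.
Let E_bil := @pbr_bilinear k H E.
Let L_bil := @pbr_bilinear k H L.
Let i_inj := @pmap_i_inj k H M E L X s.

Lemma psi_bilinear : pseudo_bilinear (psi s).
Proof.
split=> [x x' u|x u u'|f g x u]; apply: i_inj.
- by rewrite (pmapD i_lin) !psiE (linear_addE s_lin) (pbilDl E_bil).
- by rewrite (pmapD i_lin) !psiE (linear_addE i_lin) (pbilDr E_bil).
- rewrite (pmapZ i_lin) !psiE (scalable_linear s_lin) (scalable_linear i_lin).
  by case: E_bil => _ _ ->.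
Qed.

Lemma chi_bilinear : pseudo_bilinear (chi s).
Proof.
split=> [x x' y|x y y'|f g x y]; apply: i_inj.
- rewrite (pmapD i_lin) !chiE (linear_addE s_lin) (pbilDl E_bil) (pbilDl L_bil).
  by rewrite (pmapD s_lin) opprD addrACA.
- rewrite (pmapD i_lin) !chiE (linear_addE s_lin) (pbilDr E_bil) (pbilDr L_bil).
  by rewrite (pmapD s_lin) opprD addrACA.
- rewrite (pmapZ i_lin) !chiE !(scalable_linear s_lin).
  case: E_bil => _ _ ->; case: L_bil => _ _ ->.
  by rewrite (pmapZ s_lin) scalerBr.
Qed.

Lemma chi_skew : skew (chi s).
Proof.
move=> x y; apply: i_inj.
rewrite (pmapN i_lin) (pmap_sigma2 i_lin) !chiE pbr_skew (pbr_skew x y).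
by rewrite (pmapN s_lin) (pmap_sigma2 s_lin) sigma2B opprB opprK addrC.
Qed.

Lemma pmap3_compr_psi x w :
  pmap3 i (compr (psi s) x w) = compr pbr (s x) (pmap i w).
Proof.
apply/esym; apply: (compr_pmap psi_bilinear E_bil i_lin i_lin) => u.
by rewrite psiE.
Qed.

Lemma pmap3_compl_psi w u :
  pmap3 i (compl (psi s) w u) = compl pbr (pmap s w) (i u).
Proof.
apply/esym; apply: (compl_pmap psi_bilinear E_bil s_lin i_lin) => x.
by rewrite psiE.
Qed.

Lemma pmap3_compl_pbr w u :
  pmap3 i (compl pbr w u) = compl pbr (pmap i w) (i u).
Proof. exact/esym/(compl_pmap M_bil E_bil i_lin i_lin). Qed.

Lemma pmap3_compr_pbr u w :
  pmap3 i (compr pbr u w) = compr pbr (i u) (pmap i w).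
Proof. exact/esym/(compr_pmap M_bil E_bil i_lin i_lin). Qed.

Lemma pmap3_compr_chi x w :
  pmap3 i (compr (chi s) x w) =
    compr pbr (s x) (pmap s w) - pmap3 s (compr pbr x w).
Proof.
have c_bil := chi_bilinear; have iD := pmap3D i_lin; have sD := pmap3D s_lin.
move: w; apply: tens_eq_morph => [v w|v w|t y].
- by rewrite (comprD c_bil) iD.
- by rewrite (pmapD s_lin) (comprD E_bil) (comprD L_bil) sD opprD addrACA.
rewrite (pmap_pure s_lin).
rewrite (compr_pure c_bil) (compr_pure E_bil) (compr_pure L_bil).
rewrite (pmap3Z i_lin) (pmap3Z s_lin) (pmap3_insR i_lin) (pmap3_insR s_lin).
by rewrite chiE insRD insRN scalerBr.
Qed.

(* The brackets [s x, s [y, z]] coming from [psi] and [chi] cancel. *)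
Lemma pmap3_coboundary x y z :
  pmap3 i (compr (psi s) x (chi s y z) + compr (chi s) x (pbr y z)) =
    compr pbr (s x) (pbr (s y) (s z)) - pmap3 s (compr pbr x (pbr y z)).
Proof.
rewrite (pmap3D i_lin) pmap3_compr_psi pmap3_compr_chi chiE.
by rewrite addrA -(comprD E_bil) subrK.
Qed.

Lemma sec_cocycleP : nab_cocycle (sec_cocycle s).
Proof.
split=> [|||x y z u v]; first exact: chi_bilinear.
- exact: chi_skew.
- exact: psi_bilinear.
have sK : cancel i (sec_retr s) := @sec_retrK k H M E L X s.
have i3_inj := pmap3_inj i_lin (sec_retr_linear s) sK.
split; apply: i3_inj => /=.
- rewrite (pmap3B i_lin) (pmap3_sigma3 i_lin).
  rewrite pmap3_compl_pbr pmap3_compr_psi pmap3_compr_pbr !psiE -iM.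
  exact: pbr_jacobi.
- rewrite !(pmap3B i_lin) (pmap3_sigma3 i_lin) !pmap3_compr_psi !psiE.
  rewrite pmap3_compl_psi pmap3_compl_pbr chiE -pbr_jacobi.
  apply/eqP; rewrite subr_eq -(complD E_bil); apply/eqP.
  by rewrite subrK.
have regroup (V : zmodType) (a b c d e f : V) :
  a - b + c + d - e + f = (a + d) - (b + e) + (c + f).
  rewrite opprD [a + d + (- b - e)]addrACA -[RHS]addrA.
  by rewrite [d - e + _]addrCA !addrA.
rewrite regroup -sigma3D -sigma13D.
rewrite (pmap3D i_lin) (pmap3B i_lin).
rewrite (pmap3_sigma3 i_lin) (pmap3_sigma13 i_lin).
rewrite !pmap3_coboundary sigma3B sigma13B.
rewrite -(pmap3_sigma3 s_lin) -(pmap3_sigma13 s_lin).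
rewrite !sigma13_compr //; try exact: pbr_skew.
rewrite !pbr_jacobi.
have cancel4 (V : zmodType) (a b c d : V) :
  a - b - (c - d) + (- (a - c) + (b - d)) = 0.
  rewrite -[b - d]opprK -opprD; apply/eqP; rewrite subr_eq0; apply/eqP.
  by rewrite ![in LHS]opprD addrACA -[- b - _]opprD.
rewrite (pmap3N s_lin) (pmap3B s_lin) opprK cancel4.
have /addrI i30 : pmap3 i 0 + pmap3 i 0 = pmap3 i 0 + 0.
  by rewrite -(pmap3D i_lin) !addr0.
by rewrite i30.
Qed.

End SectionCocycle.

Section ChangeOfSection.
Variables (k : fieldType) (H : cocommHopfType k) (M E L : liePseudoType H).
Variables (X : nab_ext M E L).
Local Notation i := (ext_i X).
Local Notation p := (ext_p X).

Let i_lin : linear i := (ext_i_hom X).1.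
Let iM : forall u v, pbr (i u) (i v) = pmap i (pbr u v) := (ext_i_hom X).2.
Let p_lin : linear p := (ext_p_hom X).1.
Let E_bil := @pbr_bilinear k H E.

Lemma ext_pi u : p (i u) = 0.
Proof. by apply/ext_p0; exists u. Qed.

Lemma sec_decomp (s : ext_section X) e : e = i (sec_retr s e) + s (p e).
Proof. by rewrite /sec_retr sec_pre subrK. Qed.

Lemma sec_retr_sec (s : ext_section X) x : sec_retr s (s x) = 0.
Proof.
apply: (@ext_i_inj _ _ _ _ _ X).
by rewrite /sec_retr sec_pre sec_p subrr (linear_0E i_lin).
Qed.

Lemma sec_retr_add (s : ext_section X) u x : sec_retr s (i u + s x) = u.
Proof.
by rewrite (linear_addE (sec_retr_linear s)) sec_retrK sec_retr_sec addr0.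
Qed.

Lemma ext_p_add (s : ext_section X) u x : p (i u + s x) = x.
Proof. by rewrite (linear_addE p_lin) ext_pi sec_p add0r. Qed.

Section Shift.
Variables (s : ext_section X) (phi : L -> M).
Hypothesis phi_lin : linear phi.

Lemma sec_shift_linear : linear (fun x => i (phi x) + s x).
Proof.
by move=> a x y; rewrite phi_lin i_lin (sec_linear s) scalerDr addrACA.
Qed.

Definition sec_shift : ext_section X :=
  ExtSection sec_shift_linear (fun x => ext_p_add s (phi x) x).

Lemma psi_shift x u : psi sec_shift x u = psi s x u + pbr (phi x) u.
Proof.
apply: (pmap_i_inj s).
by rewrite (pmapD i_lin) !psiE -iM /= (pbilDl E_bil) addrC.
Qed.

Lemma chi_shift x y : chi sec_shift x y - chi s x y =
  psi s x (phi y) - sigma2 (psi s y (phi x)) - pmap phi (pbr x y)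
    + pbr (phi x) (phi y).
Proof.
apply: (pmap_i_inj s); rewrite !(pmapD i_lin) !(pmapN i_lin) !chiE /=.
rewrite -iM (pmap_sigma2 i_lin) !psiE.
rewrite -[sigma2 (pbr (s y) _)]opprK -pbr_skew.
have ip_lin : linear (i \o phi) by move=> a u v; rewrite /= phi_lin i_lin.
rewrite [pmap (fun x => _ + _) _](pmap_addf ip_lin (sec_linear s)).
rewrite -[pmap i _]/((pmap i \o pmap phi) _) -(pmap_comp phi_lin i_lin).
rewrite !(pbilDl E_bil) !(pbilDr E_bil).
move: (pbr _ _) (pbr _ _) (pbr _ _) (pbr _ _) (pmap _ _) (pmap _ _).
move=> a b c d e f.
rewrite opprK opprB opprD !addrA subrK [_ - f - a]addrAC addrK [RHS]addrAC.
by congr (_ - _); rewrite [RHS]addrC -addrA [c + b]addrC.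
Qed.
End Shift.

Lemma sec_diff_linear (s t : ext_section X) : linear (sec_retr s \o t).
Proof. by move=> a x y; rewrite /= (sec_linear t) (sec_retr_linear s). Qed.

Lemma sec_shiftE (s t : ext_section X) x :
  sec_shift s (sec_diff_linear s t) x = t x.
Proof. by rewrite /= [RHS](sec_decomp s) sec_p. Qed.

Lemma sec_cocycle_ext (s t : ext_section X) :
  s =1 t -> sec_cocycle s = sec_cocycle t.
Proof.
move=> st; congr pair; apply/funext => x; apply/funext => y;
  apply: (pmap_i_inj s).
  rewrite !chiE !st; congr (_ - pmap _ _).
  exact/funext.
by rewrite !psiE st.
Qed.

Lemma nab_equiv_sec_shift (s : ext_section X) phi (phi_lin : linear phi) :
  nab_equiv (sec_cocycle (sec_shift s phi_lin)) (sec_cocycle s).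
Proof.
exists phi; split=> // [x u|x y]; last exact: chi_shift.
by rewrite psi_shift addrC addKr.
Qed.

Lemma nab_equiv_sec (s t : ext_section X) :
  nab_equiv (sec_cocycle t) (sec_cocycle s).
Proof.
rewrite -(sec_cocycle_ext (sec_shiftE s t)); exact: nab_equiv_sec_shift.
Qed.

Lemma nab_equiv_secP (s : ext_section X) (c : cochain L M) :
  nab_equiv (sec_cocycle s) c <-> exists t : ext_section X, c = sec_cocycle t.
Proof.
split=> [|[t ->]]; last exact: nab_equiv_sec.
case: c => chi' psi' [phi [phi_lin psiE' chiE']].
have phiN_lin : linear (fun x => - phi x).
  by move=> a x y; rewrite phi_lin opprD scalerN.
pose t := sec_shift s phiN_lin; exists t.
have psi't : psi' = psi t.
  apply/funext => x; apply/funext => u; rewrite psi_shift.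
  rewrite (pbilNl (@pbr_bilinear k H M)) -psiE'.
  by rewrite opprB addrC subrK.
congr pair => //; apply/funext => x; apply/funext => y.
have ts : sec_shift t phi_lin =1 s.
  by move=> z /=; rewrite (linear_oppE i_lin) addNKr.
have := chi_shift t phi_lin x y; rewrite -psi't -chiE'.
have -> : chi (sec_shift t phi_lin) = chi s.
  by case: (sec_cocycle_ext ts).
by move=> /addrI /oppr_inj.
Qed.
End ChangeOfSection.

Section IsomorphicExtensions.
Variables (k : fieldType) (H : cocommHopfType k) (M E E' L : liePseudoType H).
Variables (X : nab_ext M E L) (X' : nab_ext M E' L).
Local Notation i := (ext_i X).
Local Notation p := (ext_p X).
Local Notation i' := (ext_i X').
Local Notation p' := (ext_p X').

Let i_lin : linear i := (ext_i_hom X).1.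
Let i'_lin : linear i' := (ext_i_hom X').1.
Let E_bil := @pbr_bilinear k H E.
Let E'_bil := @pbr_bilinear k H E'.

Definition ext_map (t : ext_section X) (t' : ext_section X') (e : E') : E :=
  i (sec_retr t' e) + t (p' e).

Lemma ext_map_linear t t' : linear (ext_map t t').
Proof.
move=> a e f; rewrite /ext_map (sec_retr_linear t') i_lin.
by rewrite (ext_p_hom X').1 (sec_linear t) scalerDr addrACA.
Qed.

Lemma ext_map_i t t' u : ext_map t t' (i' u) = i u.
Proof.
by rewrite /ext_map sec_retrK ext_pi (linear_0E (sec_linear t)) addr0.
Qed.

Lemma ext_map_sec t t' x : ext_map t t' (t' x) = t x.
Proof. by rewrite /ext_map sec_retr_sec sec_p (linear_0E i_lin) add0r. Qed.

Lemma ext_map_p t t' e : p (ext_map t t' e) = p' e.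
Proof. exact: ext_p_add. Qed.

Lemma ext_map_hom t t' :
  sec_cocycle t' = sec_cocycle t -> lie_hom (ext_map t t').
Proof.
move=> [chitt psitt]; have g_lin := ext_map_linear t t'.
split=> // e f; set g := ext_map t t' in g_lin *.
have gi : g \o i' = i by apply/funext => u; exact: ext_map_i.
have gt : g \o t' = t by apply/funext => u; exact: ext_map_sec.
have pgi w : pmap g (pmap i' w) = pmap i w.
  by rewrite -gi; exact/esym/(pmap_comp i'_lin g_lin).
have pgt w : pmap g (pmap t' w) = pmap t w.
  by rewrite -gt; exact/esym/(pmap_comp (sec_linear t') g_lin).
have g_ii u v : pbr (i u) (i v) = pmap g (pbr (i' u) (i' v)).
  by rewrite (ext_i_hom X).2 (ext_i_hom X').2 pgi.
have g_ti x u : pbr (t x) (i u) = pmap g (pbr (t' x) (i' u)).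
  by rewrite -!psiE pgi psitt.
have g_it u x : pbr (i u) (t x) = pmap g (pbr (i' u) (t' x)).
  by rewrite pbr_skew g_ti -(pmap_sigma2 g_lin) -(pmapN g_lin) -pbr_skew.
have g_tt x y : pbr (t x) (t y) = pmap g (pbr (t' x) (t' y)).
  rewrite -[LHS](subrK (pmap t (pbr x y))) -chiE -chitt -pgi -pgt.
  by rewrite -(pmapD g_lin) chiE subrK.
rewrite {2}(sec_decomp t' e) {2}(sec_decomp t' f).
rewrite !(pbilDl E'_bil) !(pbilDr E'_bil).
rewrite !(pmapD g_lin) -g_ii -g_ti -g_it -g_tt.
by rewrite -!(pbilDr E_bil) -(pbilDl E_bil).
Qed.

Lemma sec_cocycle_iso (t : ext_section X) (t' : ext_section X') (g : E' -> E) :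
  lie_hom g -> (forall u, g (i' u) = i u) -> (forall x, g (t' x) = t x) ->
  sec_cocycle t' = sec_cocycle t.
Proof.
move=> [g_lin gM] gi gt.
have pgi w : pmap g (pmap i' w) = pmap i w.
  rewrite -[LHS]/((pmap g \o pmap i') w) -(pmap_comp i'_lin g_lin).
  by congr pmap; exact/funext.
have pgt w : pmap g (pmap t' w) = pmap t w.
  rewrite -[LHS]/((pmap g \o pmap t') w) -(pmap_comp (sec_linear t') g_lin).
  by congr pmap; exact/funext.
congr pair; apply/funext => x; apply/funext => y; apply: (pmap_i_inj t).
  by rewrite -pgi !chiE (pmapB g_lin) pgt -gM !gt.
by rewrite -pgi !psiE -gM gi gt.
Qed.

End IsomorphicExtensions.

Lemma ext_mapK (k : fieldType) (H : cocommHopfType k)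
    (M E E' L : liePseudoType H) (X : nab_ext M E L) (X' : nab_ext M E' L)
    (t : ext_section X) (t' : ext_section X') :
  cancel (ext_map t t') (ext_map t' t).
Proof.
move=> e; rewrite {1}/ext_map sec_retr_add ext_p_add; exact/esym/sec_decomp.
Qed.

Section Twist.
Variables (k : fieldType) (H : cocommHopfType k) (M E L : liePseudoType H).
Variables (X : nab_ext M E L) (ba : aut M * aut L).
Local Notation i := (ext_i X).
Local Notation p := (ext_p X).
Local Notation beta := ba.1.
Local Notation alpha := ba.2.
Local Notation beta' := (ba.1^-1)%g.
Local Notation alpha' := (ba.2^-1)%g.
Local Open Scope classical_set_scope.

Lemma autK (Z : liePseudoType H) (f : aut Z) : cancel f (f^-1)%g.
Proof. exact: aut_funK. Qed.

Lemma autVK (Z : liePseudoType H) (f : aut Z) : cancel (f^-1)%g f.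
Proof. exact: aut_invK. Qed.

Lemma twist_exact : range (i \o beta') = (alpha \o p) @^-1` [set 0].
Proof.
have al0 : alpha 0 = 0 := linear_0E (aut_hom alpha).1.
apply/seteqP; split=> [_ [u _ <-]|e /= ape0].
  by rewrite /= ext_pi al0.
have /ext_p0[u _ <-] : p e = 0.
  by apply: (can_inj (autK alpha)); rewrite ape0 al0.
by exists (beta u) => //; congr (i _); exact: autK.
Qed.

Lemma twist_p_surj : range (alpha \o p) = [set: L].
Proof.
apply/seteqP; split=> // x _; have [e pe] := ext_p_ex X (alpha' x).
by exists e => //; rewrite /comp pe autVK.
Qed.

Definition twist : nab_ext M E L :=
  NabExt (lie_hom_comp (aut_hom beta') (ext_i_hom X))
    (lie_hom_comp (ext_p_hom X) (aut_hom alpha))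
    (inj_comp (@ext_i_inj _ _ _ _ _ X) (can_inj (autVK beta)))
    twist_exact twist_p_surj.

Variable s : ext_section X.

Lemma twist_sec_linear : linear (s \o alpha').
Proof. by move=> a x y; rewrite /comp (aut_hom alpha').1 (sec_linear s). Qed.

Lemma twist_sec_p : cancel (s \o alpha') (alpha \o p).
Proof. by move=> x; rewrite /comp sec_p autVK. Qed.

Definition twist_sec : ext_section twist :=
  ExtSection (X := twist) twist_sec_linear twist_sec_p.

Lemma act_cocycleE : act_cocycle ba (sec_cocycle s) = sec_cocycle twist_sec.
Proof.
have i_lin := (ext_i_hom X).1; have b_lin := (aut_hom beta).1.
have b'_lin := (aut_hom beta').1; have s_lin := sec_linear s.
have a'_lin := (aut_hom alpha').1.
have twist_ib w : pmap (ext_i twist) (pmap beta w) = pmap i w.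
  have ti_lin : linear (ext_i twist) := (ext_i_hom twist).1.
  rewrite -[LHS]/((pmap _ \o pmap _) w) -(pmap_comp b_lin ti_lin).
  by congr Defs.pmap; apply/funext => u; congr (i _); exact: autK.
have twist_sa w : pmap twist_sec w = pmap s (pmap alpha' w).
  exact: (pmap_comp a'_lin s_lin).
rewrite [ba in act_cocycle ba]surjective_pairing /act_cocycle.
congr pair; apply/funext => x; apply/funext => y;
  apply: (pmap_i_inj twist_sec); rewrite twist_ib.
  rewrite [LHS]chiE chiE twist_sa; congr (_ - pmap s _).
  exact: (aut_hom alpha').2.
by rewrite [LHS]psiE psiE.
Qed.

End Twist.

Section WellsExact.
Variables (k : fieldType) (H : cocommHopfType k) (M E L : liePseudoType H).
Variables (X : nab_ext M E L) (s : ext_section X).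
Local Notation i := (ext_i X).
Local Notation p := (ext_p X).
Local Open Scope classical_set_scope.

Lemma wells_H2nab ba : H2nab (sec_cocycle s) (wells s ba).
Proof.
exists (act_cocycle ba (sec_cocycle s) - sec_cocycle s) => //=.
rewrite addrC subrK act_cocycleE; exact: sec_cocycleP.
Qed.

Lemma wells_trivialP ba :
  wells s ba = nab_class (sec_cocycle s) 0 <->
    exists t : ext_section (twist X ba), sec_cocycle t = sec_cocycle s.
Proof.
have class_act d : wells s ba d <-> nab_cocycle (sec_cocycle s + d) /\
    nab_equiv (sec_cocycle (twist_sec ba s)) (sec_cocycle s + d).
  by rewrite /wells /nab_class /mkset [_ + (_ - _)]addrC subrK act_cocycleE.
have class_0 d : nab_class (sec_cocycle s) 0 d <->
    nab_cocycle (sec_cocycle s + d) /\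
    nab_equiv (sec_cocycle s) (sec_cocycle s + d).
  by rewrite /nab_class /mkset addr0.
split=> [ws|[t ts]].
  have /class_act[_] : wells s ba 0.
    rewrite ws; apply/class_0; rewrite addr0.
    by split; [exact: sec_cocycleP | exact: nab_equiv_sec].
  by rewrite addr0 => /nab_equiv_secP[t ->]; exists t.
apply/seteqP; split=> d.
  move=> /class_act[dc de]; apply/class_0; split=> //; move: de.
  by rewrite -ts => /nab_equiv_secP[t' ->]; exact: nab_equiv_sec.
move=> /class_0[dc de]; apply/class_act; split=> //; move: de.
by rewrite -ts => /nab_equiv_secP[t' ->]; exact: nab_equiv_sec.
Qed.

Lemma tau_section (g : AutM X) :
  exists t : ext_section (twist X (tau s g)), sec_cocycle t = sec_cocycle s.
Proof.
have [g_lin gM] := aut_hom (val g).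
pose h := (val g)^-1%g; have hK : cancel h (val g) := autVK (val g).
have t_lin : linear (h \o s).
  by move=> a x y; rewrite /comp (sec_linear s) (aut_hom h).1.
have t_p : cancel (h \o s) (ext_p (twist X (tau s g))).
  by move=> x; rewrite /= quo_funE hK sec_p.
exists (ExtSection (X := twist X (tau s g)) t_lin t_p).
apply: (sec_cocycle_iso (aut_hom (val g))) => [u|x] /=; last exact: hK.
rewrite -restr_funE; congr (i _); exact: (autVK (tau s g).1).
Qed.

Lemma section_tau ba (t : ext_section (twist X ba)) :
  sec_cocycle t = sec_cocycle s -> exists g : AutM X, tau s g = ba.
Proof.
move=> ts; pose g := Aut (ext_map_hom ts)
  (Bijective (ext_mapK s t) (ext_mapK t s)).
have gi u : g (i u) = i (ba.1 u).
  by rewrite -[in LHS](autK ba.1 u); exact: ext_map_i.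
have gp e : p (g e) = ba.2 (p e) by exact: ext_map_p.
have gM : g \in AutM_pred X.
  apply/asboolP/seteqP; split=> [_ [_ [u _ <-] <-]|_ [u _ <-]].
    by exists (ba.1 u) => //; rewrite gi.
  exists (i (ba.1^-1 u)%g); first by exists (ba.1^-1 u)%g.
  by rewrite gi autVK.
exists (MkAutM gM); rewrite [RHS]surjective_pairing.
congr pair; apply: aut_ext => x /=.
  by apply: (@ext_i_inj _ _ _ _ _ X); rewrite restr_funE gi.
by rewrite /quo_fun gp sec_p.
Qed.

End WellsExact.

Local Open Scope classical_set_scope.

Theorem theorem5 (k : fieldType) (H : cocommHopfType k)
    (M E L : liePseudoType H) (X : nab_ext M E L) (s : ext_section X) :
  [/\ injective (@AutML_incl _ _ _ _ _ X s),
      range (@AutML_incl _ _ _ _ _ X s) = [set g | tau s g = 1%g],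
      (forall ba : aut M * aut L, H2nab (sec_cocycle s) (wells s ba))
    & range (tau s) = [set ba | wells s ba = nab_class (sec_cocycle s) 0%R] ].
Proof.
split; [exact: val_inj | | exact: wells_H2nab |].
- apply/seteqP; split=> [_ [g _ <-]|g /eqP tau_g].
    exact/eqP/(valP g).
  by exists (MkAutML tau_g).
- apply/seteqP; split=> [_ [g _ <-]|ba /wells_trivialP[t ts]].
    exact/wells_trivialP/tau_section.
  by have [g <-] := section_tau ts; exists g.
Qed.
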